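(* The parameter set $\Theta$ splits into two-element, four-element and one-element classes of parameters that define the same autocovariance function (that is, the classes of the equivalence relation $\theta\sim\theta'\iff\gamma_\theta=\gamma_{\theta'}$ on $\Theta$) as follows, for $(a,b,c,\sigma_\epsilon^2)\in\Theta$: 1. In the generic case $c\ne -ab$ and $c\neq 0$, the parameter $(a,b,c,\sigma_\epsilon^2)$ belongs to a two-element class. It determines the same autocovariance function as the parameter $(-b/c,\,-a/c,\,1/c,\,c^{-2}\sigma_\epsilon^2)$. 2. In the symmetric case $c=-ab\neq 0$, the parameter $(a,b,-ab,\sigma_\epsilon^2)$ belongs to a four-element class. The four parameters $$(a,\,b,\,-ab,\,\sigma_\epsilon^2),\quad (a^{-1},\,b^{-1},\,-a^{-1}b^{-1},\,a^{-2}b^{-2}\sigma_\epsilon^2),\quad (a^{-1},\,b,\,-a^{-1}b,\,a^{-2}\sigma_\epsilon^2),\quad (a,\,b^{-1},\,-ab^{-1},\,b^{-2}\sigma_\epsilon^2)$$ determine the same autocovariance function. 3. In the symmetric case $a\neq0$, $b=c=0$, the parameter $(a,0,0,\sigma_\epsilon^2)$ belongs to a two-element class. It determines the same autocovariance function as the parameter $(a^{-1},0,0,a^{-2}\sigma_\epsilon^2)$. Similarly, if $b\neq0$ and $a=c=0$, then the parameter $(0,b,0,\sigma_\epsilon^2)$ belongs to a two-element class and determines the same autocovariance function as the parameter $(0,b^{-1},0,b^{-2}\sigma_\epsilon^2)$. 4. If $c=0$ and $ab\neq 0$, the parameter $(a,b,0,\sigma_\epsilon^2)$ makes a class of its own.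 Likewise, for $a=b=c=0$, the parameter $(0,0,0,\sigma_\epsilon^2)$ makes a class of its own.
   Context: The parameter set is $$\Theta=\{(a,b,c,v)\in\mathbb{R}^4:\ (1-a-b-c)(1-a+b+c)(1+a-b+c)(1+a+b-c)>0,\ v>0\}.$$ For $\theta=(a,b,c,\sigma_\epsilon^2)\in\Theta$, $\gamma_\theta$ denotes the autocovariance function $\gamma_X(h_1,h_2)=\operatorname{cov}(X_{i,j},X_{i-h_1,j-h_2})$, $h_1,h_2\in\mathbb{Z}$, of a wide-sense stationary field $X$ on $\mathbb{Z}^2$ satisfying $X_{i,j}=aX_{i-1,j}+bX_{i,j-1}+cX_{i-1,j-1}+\epsilon_{i,j}$ for all $i,j$, where the $\epsilon_{i,j}$ are uncorrelated, zero-mean, with variance $\sigma_\epsilon^2$. It depends only on $\theta$ and equals $$\gamma_\theta(h_1,h_2)=\int_{-1/2}^{1/2}\int_{-1/2}^{1/2}\frac{\sigma_\epsilon^2\exp(2\pi\mathrm{i}(h_1\nu_1+h_2\nu_2))}{|1-ae^{2\pi\mathrm{i}\nu_1}-be^{2\pi\mathrm{i}\nu_2}-ce^{2\pi\mathrm{i}(\nu_1+\nu_2)}|^2}\,d\nu_1\,d\nu_2 .$$ *)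

(* Defs.v *)
From HB Require Import structures.
From mathcomp Require Import all_boot all_order all_algebra.
From mathcomp Require Import all_classical all_reals all_analysis.

Set Implicit Arguments.
Unset Strict Implicit.
Unset Printing Implicit Defensive.

Import Order.TTheory GRing.Theory Num.Theory.

Local Open Scope classical_set_scope.
Local Open Scope ring_scope.

(* A parameter (a, b, c, v) consists of the three coefficients of the
   recursion and of the variance v of the noise. *)
Definition param (R : realType) : Type := (R * R * R * R)%type.

Definition Theta (R : realType) : set (param R) :=
  [set t | let: (a, b, c, v) := t in
     0 < (1 - a - b - c) * (1 - a + b + c) * (1 + a - b + c) * (1 + a + b - c)
     /\ 0 < v].

Section random_fields.
Context (d : measure_display) (T : measurableType d) (R : realType)
  (P : probability T R).
Implicit Types X eps : int -> int -> T -> R.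

(* The membership in Lfun P 2 means measurable and square-integrable, so that
   all means and covariances below are finite. *)
Definition white_noise eps (v : R) : Prop :=
  [/\ forall i j, eps i j \in Lfun P 2%:E,
      forall i j, ('E_P[eps i j] = 0%:E)%E,
      forall i j, ('V_P[eps i j] = v%:E)%E &
      forall i j k l, (i, j) != (k, l) ->
        covariance P (eps i j) (eps k l) = 0%:E].

Definition wide_sense_stationary X (gamma : int -> int -> R) : Prop :=
  [/\ forall i j, X i j \in Lfun P 2%:E,
      exists m : R, forall i j, ('E_P[X i j] = m%:E)%E &
      forall i j h1 h2,
        covariance P (X i j) (X (i - h1) (j - h2)) = (gamma h1 h2)%:E].

Definition ar_field (a b c : R) X eps : Prop :=
  forall i j, {ae P, forall w,
    X i j w = a * X (i - 1) j w + b * X i (j - 1) w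
              + c * X (i - 1) (j - 1) w + eps i j w}.

End random_fields.

Definition is_autocov (R : realType) (t : param R) (gamma : int -> int -> R)
  : Prop :=
  let: (a, b, c, v) := t in
  exists (d : measure_display) (T : measurableType d) (P : probability T R)
         (X eps : int -> int -> T -> R),
    [/\ white_noise P eps v,
        wide_sense_stationary P X gamma &
        ar_field P a b c X eps].

(* For t in Theta there is exactly one function satisfying [is_autocov t]: the
   recursion has a wide-sense stationary solution, with spectral density
   v / |1 - a e^(2 pi i x) - b e^(2 pi i y) - c e^(2 pi i (x + y))|^2, and its
   autocovariance function depends on t only. The default value 0 plays no
   role on Theta. *)
Definition autocov (R : realType) (t : param R) : int -> int -> R :=
  xget (fun _ _ => 0) [set gamma | is_autocov t gamma].

Definition autocov_class (R : realType) (t : param R) : set (param R) :=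
  [set t' | Theta t' /\ autocov t = autocov t'].

(* Main.v *)
(* The autocovariance gamma of a parameter t = (a, b, c, v) is the only bounded
   solution of the Yule-Walker equation K gamma = v delta_0, where
   K = |1 - a z - b w - c z w|^2 acts as a convolution operator on functions on
   Z^2.  Since convolutions commute, two parameters have the same
   autocovariance if and only if K / v and K' / v' have the same coefficients,
   and the classes come from solving these polynomial equations: the
   discriminants of the symbol in z and in w are squares, which leaves two sign
   choices in each variable.

   Existence and uniqueness of gamma rest on the coercivity of the operator
   1 - a z - b w - c z w on l^2, which is where Theta enters.  By coercivity,
   the residuals r_n = (1 - tau K)^n delta_0 decay geometrically in l^2; as they
   are supported in boxes of polynomial size, this gives uniqueness, and the
   Neumann series of K gives psi in l^2 with
   (1 - a z - b w - c z w) psi = delta_0, hence the moving-average field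
   X_p = sum_q psi(p - q) eps_q. *)
Require Import Defs.
From HB Require Import structures.
From mathcomp Require Import all_boot all_order all_algebra.
From mathcomp Require Import all_classical all_reals all_analysis.
From mathcomp Require Import measurable_realfun ring lra zify.

Set Implicit Arguments.
Unset Strict Implicit.
Unset Printing Implicit Defensive.

Import Order.TTheory GRing.Theory Num.Theory.
Import numFieldNormedType.Exports.

Local Open Scope classical_set_scope.
Local Open Scope ring_scope.

(** * Finitely supported functions and linear filters *)

Section finitely_supported.
Context (R : realType) (G : zmodType).
Implicit Types (f g : G -> R) (l : seq (R * G)).

Definition fin_supp f := finite_set [set x | f x != 0].

(** A finite-support sum, worth 0 on a function of infinite support; hence the [fin_supp] hypotheses
    below. *)
Definition tot f := \sum_(x \in [set: G]) f x.

Lemma fin_supp_sub f g :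
  fin_supp f -> (forall x, f x = 0 -> g x = 0) -> fin_supp g.
Proof.
move=> + fg; apply: sub_finite_set => x /=.
by apply: contra_neq; exact: fg.
Qed.

Lemma fin_suppD f g : fin_supp f -> fin_supp g -> fin_supp (f \+ g).
Proof.
move=> ff fg; apply: (@sub_finite_set _ _ ([set x | f x != 0] `|` [set x | g x != 0])).
  move=> x /=; have [->|] := eqVneq (f x) 0; last by left.
  by rewrite add0r; right.
by rewrite finite_setU.
Qed.

Lemma fin_supp_sum (I : Type) (r : seq I) (F : I -> G -> R) :
  (forall i, fin_supp (F i)) -> fin_supp (fun x => \sum_(i <- r) F i x).
Proof.
move=> FF; elim: r => [|i r IH].
  apply: (@sub_finite_set _ _ set0) => // x /=.
  by rewrite big_nil eqxx.
have := fin_suppD (FF i) IH; congr fin_supp.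
by apply/funext => x; rewrite big_cons.
Qed.

Lemma fin_supp_shift f s : fin_supp f -> fin_supp (fun x => f (x - s)).
Proof.
move=> ff; apply: (sub_finite_set _ (finite_image (fun x => x + s) ff)).
by move=> x /= fx; exists (x - s) => //; rewrite subrK.
Qed.

Lemma tot_on (A : set G) f : finite_set A -> (forall x, ~ A x -> f x = 0) ->
  tot f = \sum_(x \in A) f x.
Proof.
move=> finA Af; rewrite /tot; apply/esym/fsbig_widen => // x [_ nAx] /=.
exact: Af.
Qed.

Lemma totD f g : fin_supp f -> fin_supp g -> tot (fun x => f x + g x) = tot f + tot g.
Proof.
move=> ff fg.
pose A := [set x | f x != 0] `|` [set x | g x != 0].
have finA : finite_set A by rewrite finite_setU.
rewrite !(@tot_on A)// ?fsbig_split// => x; rewrite /A/= => /not_orP[].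
- by move=> _ /negP; rewrite negbK => /eqP.
- by move=> /negP; rewrite negbK => /eqP.
- by move=> /negP; rewrite negbK => /eqP -> /negP; rewrite negbK => /eqP ->; rewrite addr0.
Qed.

Lemma totZ k f : tot (fun x => k * f x) = k * tot f.
Proof. by rewrite /tot mulr_fsumr. Qed.

Lemma tot_sum (I : Type) (r : seq I) (F : I -> G -> R) :
  (forall i, fin_supp (F i)) ->
  tot (fun x => \sum_(i <- r) F i x) = \sum_(i <- r) tot (F i).
Proof.
move=> FF; elim: r => [|i r IH].
  by rewrite big_nil /tot fsbig1// => x _; rewrite big_nil.
rewrite big_cons -IH -totD//; last exact: fin_supp_sum.
by congr tot; apply/funext => x; rewrite big_cons.
Qed.

Lemma tot_shift f s : tot (fun x => f (x - s)) = tot f.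
Proof.
rewrite /tot [RHS](reindex_fsbigT (fun x => x - s))//.
by exists (fun x => x + s) => x; rewrite ?addrK ?subrK.
Qed.

Lemma tot_ge0 f : (forall x, 0 <= f x) -> 0 <= tot f.
Proof. by move=> f0; apply: fsumr_ge0 => x _. Qed.

Lemma ler_tot f g : fin_supp f -> fin_supp g -> (forall x, f x <= g x) ->
  tot f <= tot g.
Proof.
move=> ff fg fgx; rewrite -subr_ge0 -mulN1r -totZ -totD//; last first.
  by apply: fin_supp_sub ff _ => x ->; rewrite mulr0.
by apply: tot_ge0 => x; rewrite mulN1r subr_ge0.
Qed.

Lemma tot_seq (s : seq G) f : uniq s ->
  tot (fun x => if x \in s then f x else 0) = \sum_(x <- s) f x.
Proof.
move=> us; rewrite (@tot_on [set` s])//; last by move=> x /= /negP/negPf ->.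
rewrite -fsbig_seq// big_seq [RHS]big_seq.
by apply: eq_bigr => x xs; rewrite xs.
Qed.

Lemma ler_sum_tot (s : seq G) f : fin_supp f -> (forall y, 0 <= f y) -> uniq s ->
  \sum_(x <- s) f x <= tot f.
Proof.
move=> ff f0 us; rewrite -tot_seq//.
apply: ler_tot => // [|y]; last by case: ifP.
by apply: fin_supp_sub ff _ => y ->; rewrite if_same.
Qed.

Lemma tot_ge f x : fin_supp f -> (forall y, 0 <= f y) -> f x <= tot f.
Proof.
by move=> ff f0; have := @ler_sum_tot [:: x] _ ff f0 erefl; rewrite big_seq1.
Qed.

Lemma fin_supp_mull f g : fin_supp f -> fin_supp (fun x => f x * g x).
Proof. by move=> ff; apply: fin_supp_sub ff _ => x ->; rewrite mul0r. Qed.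

Lemma fin_supp_mulr f g : fin_supp f -> fin_supp (fun x => g x * f x).
Proof. by move=> ff; apply: fin_supp_sub ff _ => x ->; rewrite mulr0. Qed.

Lemma fin_suppX f n : fin_supp f -> fin_supp (fun x => f x ^+ n.+1).
Proof. by move=> ff; apply: fin_supp_sub ff _ => x ->; rewrite expr0n. Qed.

Definition sqn f := tot (fun x => f x ^+ 2).

Lemma sqn_ge0 f : 0 <= sqn f.
Proof. by apply: tot_ge0 => x; exact: sqr_ge0. Qed.

Lemma sqnZ k f : sqn (fun x => k * f x) = k ^+ 2 * sqn f.
Proof. by rewrite /sqn -totZ; congr tot; apply/funext => x; rewrite exprMn. Qed.

Lemma sqn_shift f s : sqn (fun x => f (x - s)) = sqn f.
Proof. exact: (tot_shift (fun x => f x ^+ 2)). Qed.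

(** The two sides differ by the sum of the squares (e f - g)^2 / e. A small weight [e] keeps the
    factor of [sqn f] close to 1. *)
Lemma sqnD_le (e : R) f g : 0 < e -> fin_supp f -> fin_supp g ->
  sqn (fun x => f x + g x) <= (1 + e) * sqn f + (1 + e^-1) * sqn g.
Proof.
move=> e0 ff fg; rewrite /sqn -!totZ -totD; last 2 first.
- exact/fin_supp_mulr/fin_suppX.
- exact/fin_supp_mulr/fin_suppX.
apply: ler_tot.
- exact/fin_suppX/fin_suppD.
- by apply: fin_suppD; exact/fin_supp_mulr/fin_suppX.
move=> x; rewrite -subr_ge0.
have -> : (1 + e) * f x ^+ 2 + (1 + e^-1) * g x ^+ 2 - (f x + g x) ^+ 2 =
  e^-1 * (e * f x - g x) ^+ 2 by field; rewrite gt_eqF.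
by rewrite mulr_ge0 ?sqr_ge0// invr_ge0 ltW.
Qed.

Definition lfilter l f x := \sum_(p <- l) p.1 * f (x - p.2).

(** Reflecting the shifts gives the adjoint filter, whose symbol on the torus is the complex
    conjugate. *)
Definition flip l := [seq (p.1, - p.2) | p <- l].

Lemma fin_supp_lfilter l f : fin_supp f -> fin_supp (lfilter l f).
Proof. by move=> ff; apply: fin_supp_sum => p; exact/fin_supp_mulr/fin_supp_shift. Qed.

Lemma lfilter_cons p l f x : lfilter (p :: l) f x = p.1 * f (x - p.2) + lfilter l f x.
Proof. by rewrite /lfilter big_cons. Qed.

Lemma lfilterD l f g x : lfilter l (fun y => f y + g y) x = lfilter l f x + lfilter l g x.
Proof. by rewrite /lfilter -big_split/=; apply: eq_bigr => p _; rewrite mulrDr. Qed.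

Lemma lfilterZ l k f x : lfilter l (fun y => k * f y) x = k * lfilter l f x.
Proof. by rewrite /lfilter mulr_sumr; apply: eq_bigr => p _; rewrite mulrCA. Qed.

Lemma lfilter_sum (I : Type) (r : seq I) l (F : I -> G -> R) x :
  lfilter l (fun y => \sum_(i <- r) F i y) x = \sum_(i <- r) lfilter l (F i) x.
Proof. by rewrite /lfilter exchange_big/=; apply: eq_bigr => p _; rewrite mulr_sumr. Qed.

Lemma lfilter_comm l l' f : lfilter l (lfilter l' f) = lfilter l' (lfilter l f).
Proof.
apply/funext => x; rewrite /lfilter.
under eq_bigr do rewrite mulr_sumr.
under [RHS]eq_bigr do rewrite mulr_sumr.
rewrite exchange_big/=; apply: eq_bigr => p _; apply: eq_bigr => q _.
by rewrite mulrCA addrAC.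
Qed.

(** Summation by parts, from translation invariance. Only [f] has finite support, so that [g] may be
    merely bounded. *)
Lemma tot_lfilter_adj l f g : fin_supp f ->
  tot (fun x => lfilter l f x * g x) = tot (fun x => f x * lfilter (flip l) g x).
Proof.
move=> ff; rewrite /lfilter/flip.
under eq_fun do rewrite mulr_suml.
under [in RHS]eq_fun do rewrite mulr_sumr big_map.
rewrite !tot_sum; last 2 first.
- by move=> p; exact: fin_supp_mull.
- by move=> p; exact/fin_supp_mull/fin_supp_mulr/fin_supp_shift.
apply: eq_bigr => -[k s] _ /=.
rewrite -[RHS](tot_shift _ s); congr tot; apply/funext => x.
by rewrite opprK subrK mulrCA mulrA.
Qed.

(** The reflection y -> x - y undoes [flip]: a filter moves freely across a convolution. *)
Lemma tot_lfilter_refl l f g x : fin_supp f ->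
  tot (fun y => lfilter l f y * g (x - y)) = tot (fun y => f y * lfilter l g (x - y)).
Proof.
move=> ff; rewrite (@tot_lfilter_adj _ _ (fun y => g (x - y)))//.
congr tot; apply/funext => y; congr (_ * _).
by rewrite /lfilter big_map/=; apply: eq_bigr => p _; rewrite opprB addrA addrAC.
Qed.

Lemma sqn_lfilter_bounded l :
  exists2 M, 0 < M & forall f, fin_supp f -> sqn (lfilter l f) <= M * sqn f.
Proof.
elim: l => [|[k s] l [M M0 IH]].
  exists 1 => // f _; rewrite mul1r; apply: le_trans (sqn_ge0 f).
  by rewrite /sqn /tot fsbig1// => x _; rewrite /lfilter big_nil expr0n.
exists (2 * k ^+ 2 + 2 * M) => [|f ff].
  by apply: ltr_wpDl; [rewrite mulr_ge0 ?sqr_ge0 | rewrite mulr_gt0].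
rewrite (_ : lfilter _ _ = fun x => k * f (x - s) + lfilter l f x); last first.
  by apply/funext => x; rewrite lfilter_cons.
apply: (le_trans (@sqnD_le 1 _ _ ltr01 _ _)).
- exact/fin_supp_mulr/fin_supp_shift.
- exact: fin_supp_lfilter.
rewrite sqnZ sqn_shift invr1; move: (IH _ ff).
move: (sqn _) (sqn f) => u w; lra.
Qed.

Lemma sqn_lfilter_flip l f : fin_supp f ->
  tot (fun x => f x * lfilter (flip l) (lfilter l f) x) = sqn (lfilter l f).
Proof.
by move=> ff; rewrite -tot_lfilter_adj//; congr tot; apply/funext => x; rewrite expr2.
Qed.

End finitely_supported.

(** * Coercivity of the autoregressive filter *)

Section coercive.
Context (R : realType) (G : zmodType).
Implicit Types (f g : G -> R) (l : seq (R * G)).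

(** Expresses without Fourier analysis that the symbol of [l] is bounded away from 0 on the
    torus. *)
Definition coercive l :=
  exists2 mu, 0 < mu & forall f, fin_supp f -> mu * sqn f <= sqn (lfilter l f).

(** The counterpart of |k + m z|^2 = k^2 + m^2 + 2 k m Re z on the unit circle, with the
    autocorrelation of [f] at [s] in the role of Re z. *)
Lemma sqn_shift_comb k m s f : fin_supp f ->
  sqn (fun x => k * f x + m * f (x - s)) =
  (k ^+ 2 + m ^+ 2) * sqn f + 2 * k * m * tot (fun x => f x * f (x - s)).
Proof.
move=> ff; rewrite mulrDl -[in m ^+ 2 * _](sqn_shift f s) -!sqnZ /sqn -!totZ -!totD.
- by congr tot; apply/funext => x; ring.
- by apply: fin_suppD; apply: fin_suppX; apply: fin_supp_mulr => //; exact: fin_supp_shift.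
- exact/fin_supp_mulr/fin_supp_mull.
- exact/fin_suppX/fin_supp_mulr.
- exact/fin_suppX/fin_supp_mulr/fin_supp_shift.
Qed.

(** The counterpart of |Re z| <= 1: the sum and the difference of [f] and its shift have nonnegative
    square sums. *)
Lemma tot_shift_le f s : fin_supp f -> `|tot (fun x => f x * f (x - s))| <= sqn f.
Proof.
move=> ff; rewrite ler_norml.
have := sqn_ge0 (fun x => 1 * f x + 1 * f (x - s)).
have := sqn_ge0 (fun x => 1 * f x + -1 * f (x - s)).
rewrite !sqn_shift_comb//; move: (tot _) (sqn f) => u w; lra.
Qed.

Definition ar_op (a b c : R) (s t : G) : seq (R * G) :=
  [:: (1, 0); (- a, s); (- b, t); (- c, s + t)].

(* The polynomial 1 - a z - b w - c z w is split as u - w (b + c z) with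
   u = 1 - a z; on the unit circle |u|^2 and |b + c z|^2 differ by
   E - 2 F Re z, which the assumption keeps away from 0. *)
Lemma coercive_ar_op a b c s t :
  4 * (a + b * c) ^+ 2 < (1 + a ^+ 2 - b ^+ 2 - c ^+ 2) ^+ 2 ->
  coercive (ar_op a b c s t).
Proof.
set E := (X in _ < X ^+ 2); set F := a + b * c => FE.
(* [eta] bounds |E - 2 F Re z| from below, [Q] will bound the square sums of both halves of the
   filter, and [e] satisfies e Q = eta / 4, so that the errors in [sqnD_le] stay below the gap. *)
pose eta := `|E| - 2 * `|F|.
have eta0 : 0 < eta.
  rewrite subr_gt0 -(@ltr_pXn2r _ 2)// ?nnegrE ?mulr_ge0// exprMn !real_normK ?num_real//.
  by rewrite (_ : 2 ^+ 2 = 4)//; ring.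
pose Q := 2 + 2 * (a ^+ 2 + b ^+ 2 + c ^+ 2).
have Q0 : 0 < Q by rewrite /Q ltr_wpDr// mulr_ge0// !addr_ge0// sqr_ge0.
pose e := eta / (4 * Q).
have e0 : 0 < e by rewrite divr_gt0// mulr_gt0.
have eQ : 4 * (e * Q) = eta by rewrite /e; field; rewrite gt_eqF.
exists ((eta / 2) / (1 + e^-1)) => [|f ff].
  by rewrite !divr_gt0// ltr_wpDr// invr_ge0 ltW.
rewrite mulrAC ler_pdivrMr; last by rewrite ltr_wpDr// invr_ge0 ltW.
pose u x := 1 * f x + - a * f (x - s).
pose w x := b * f x + c * f (x - s).
pose y := lfilter (ar_op a b c s t) f.
have fy : fin_supp y by exact: fin_supp_lfilter.
have fu : fin_supp u.
  by apply: fin_suppD; apply: fin_supp_mulr => //; exact: fin_supp_shift.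
have fw : fin_supp w.
  by apply: fin_suppD; apply: fin_supp_mulr => //; exact: fin_supp_shift.
have yE x : y x = u x - w (x - t).
  rewrite /y /lfilter /ar_op !big_cons big_nil /= subr0 /u /w.
  rewrite (_ : x - (s + t) = x - t - s); first by ring.
  by rewrite opprD addrCA addrC.
(* The sign of [E] is unknown, so [sqnD_le] is used both ways: for u as shifted w plus y, and for
   shifted w as u minus y. *)
have := @sqnD_le _ _ e (fun x => w (x - t)) y e0 (fin_supp_shift _ fw) fy.
rewrite (_ : (fun x => _ + _) = u); last first.
  by apply/funext => x; rewrite yE addrC subrK.
have := @sqnD_le _ _ e u (fun x => -1 * y x) e0 fu (fin_supp_mulr _ fy).
rewrite (_ : (fun x => _ + _) = fun x => w (x - t)); last first.
  by apply/funext => x; rewrite yE; ring.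
rewrite sqnZ sqn_shift -/y {fu fw yE}/u {}/w !sqn_shift_comb//.
have := tot_shift_le s ff; have := sqn_ge0 f.
move: (sqn f) (sqn y) (tot _) => S Y T S0 ST.
set U := _ + 2 * 1 * - a * T; set W := _ + 2 * b * c * T => Wle Ule.
have TS k : 2 * k * T <= 2 * `|k| * S.
  apply: le_trans (ler_norm _) _; rewrite !normrM ger0_norm// -!mulrA.
  by rewrite ler_wpM2l// ler_wpM2l.
have UQ : U <= Q * S.
  rewrite /U /Q; have := TS (- a); have := mulr_ge0 (sqr_ge0 (`|a| - 1)) S0.
  rewrite normrN -(real_normK (num_real a)); have := mulr_ge0 (sqr_ge0 b) S0.
  have := mulr_ge0 (sqr_ge0 c) S0; rewrite sqrrN -(real_normK (num_real a)); lra.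
have WQ : W <= Q * S.
  rewrite /W /Q; have := TS (b * c); rewrite normrM.
  have := mulr_ge0 (sqr_ge0 (`|b| - `|c|)) S0; have := mulr_ge0 (sqr_ge0 a) S0.
  rewrite -(real_normK (num_real b)) -(real_normK (num_real c)); lra.
have eWQ : 4 * (e * W) <= eta * S.
  by move: WQ; rewrite -(ler_pM2l e0) -eQ; lra.
have eUQ : 4 * (e * U) <= eta * S.
  by move: UQ; rewrite -(ler_pM2l e0) -eQ; lra.
have UW : U - W = E * S - 2 * F * T by rewrite /U /W /E /F; ring.
have := TS F; have := TS (- F); rewrite normrN.
have : `|E| * S = 2 * `|F| * S + eta * S by rewrite /eta; ring.
have [E0|E0] := leP 0 E; [rewrite ger0_norm// | rewrite ltr0_norm//]; lra.
Qed.

End coercive.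

(** * Inversion of a coercive filter *)

Section relaxation.
Context (R : realType) (G : zmodType).
Implicit Types (f g : G -> R) (l : seq (R * G)).

Definition impulse (x : G) : R := (x == 0)%:R.

Lemma impulse_eq0 x : x != 0 -> impulse x = 0.
Proof. by rewrite /impulse => /negPf ->. Qed.

Lemma fin_supp_impulse : fin_supp impulse.
Proof.
apply: (@sub_finite_set _ _ [set 0]) => // x; rewrite /impulse /=.
by case: (eqVneq x 0) => [->|_] /=; rewrite ?eqxx.
Qed.

Lemma tot_impulse g : tot (fun y => impulse y * g y) = g 0.
Proof.
rewrite (@tot_on _ _ [set 0])//; first by rewrite fsbig_set1 /impulse eqxx mul1r.
by move=> y /= /eqP/negPf y0; rewrite /impulse y0 mul0r.
Qed.

Lemma sqn_impulse : sqn impulse = 1.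
Proof.
rewrite /sqn; under eq_fun do rewrite expr2.
by rewrite tot_impulse /impulse eqxx.
Qed.

Definition relax tau l f x := f x - tau * lfilter (flip l) (lfilter l f) x.

Lemma fin_supp_relax tau l f : fin_supp f -> fin_supp (relax tau l f).
Proof.
move=> ff; rewrite /relax; under eq_fun do rewrite -mulNr.
by apply: fin_suppD => //; exact/fin_supp_mulr/fin_supp_lfilter/fin_supp_lfilter.
Qed.

Lemma sqn_relax tau l f : fin_supp f ->
  sqn (relax tau l f) = sqn f - 2 * tau * sqn (lfilter l f)
    + tau ^+ 2 * sqn (lfilter (flip l) (lfilter l f)).
Proof.
move=> ff; rewrite -(sqn_lfilter_flip l ff) -sqnZ -mulNr -totZ /sqn.
have fk := fin_supp_lfilter (flip l) (fin_supp_lfilter l ff).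
rewrite -!totD.
- by congr tot; apply/funext => x; rewrite /relax; ring.
- by apply: fin_suppD; [exact: fin_suppX | exact/fin_supp_mulr/fin_supp_mull].
- exact/fin_suppX/fin_supp_mulr.
- exact: fin_suppX.
- exact/fin_supp_mulr/fin_supp_mull.
Qed.

(** For tau = 1 / M the quadratic term in [sqn_relax] costs at most half of the linear gain, so the
    square sum drops by at least tau [sqn (lfilter l f)], which coercivity bounds below by tau mu
    [sqn f]. *)
Lemma relax_contraction l : coercive l ->
  exists tau rho, [/\ 0 < tau, 0 < rho < 1 &
    forall f, fin_supp f -> sqn (relax tau l f) <= rho * sqn f].
Proof.
move=> [mu mu0 lmu]; have [M M0 lM] := sqn_lfilter_bounded (flip l).
have tm0 : 0 < M^-1 * mu by rewrite mulr_gt0 ?invr_gt0.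
have p1 : 0 < 1 + M^-1 * mu by rewrite addr_gt0.
(* The factor obtained is 1 - mu / M; its upper bound 1 / (1 + mu / M) is visibly positive. *)
exists M^-1, (1 + M^-1 * mu)^-1; split.
- by rewrite invr_gt0.
- by rewrite invr_gt0 p1/= invf_lt1// ltrDl.
move=> f ff; rewrite sqn_relax//.
have /lM := fin_supp_lfilter l ff; have := lmu _ ff; have S0 := sqn_ge0 f.
move: (sqn f) S0 (sqn (lfilter (flip l) _)) => S S0 Q.
move: (sqn (lfilter l f)) => P SP PQ.
have MQ : M^-1 ^+ 2 * Q <= M^-1 * P.
  by rewrite expr2 -mulrA ler_pM2l ?invr_gt0// ler_pdivrMl.
have tS : M^-1 * mu * S <= M^-1 * P by rewrite -mulrA ler_pM2l ?invr_gt0.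
have tle : 1 - M^-1 * mu <= (1 + M^-1 * mu)^-1.
  rewrite -[leRHS]div1r ler_pdivlMr//.
  by have := sqr_ge0 (M^-1 * mu); lra.
apply: (@le_trans _ _ ((1 - M^-1 * mu) * S)); last by rewrite ler_wpM2r.
by move: MQ tS; move: (M^-1 ^+ 2 * Q) (M^-1 * mu) => u w; lra.
Qed.

Definition residual tau l n := iter n (relax tau l) impulse.

Lemma fin_supp_residual tau l n : fin_supp (residual tau l n).
Proof. by elim: n => [|n IH]; [exact: fin_supp_impulse | exact: fin_supp_relax]. Qed.

Lemma sqn_residual tau rho l n : 0 <= rho ->
  (forall f, fin_supp f -> sqn (relax tau l f) <= rho * sqn f) ->
  sqn (residual tau l n) <= rho ^+ n.
Proof.
move=> rho0 contr; elim: n => [|n IH]; first by rewrite sqn_impulse.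
rewrite exprS; apply: le_trans (contr _ (fin_supp_residual _ _ _)) _.
by rewrite ler_wpM2l.
Qed.

(** Convolution with the impulse returns [g], and a relaxation step changes nothing: K moves across
    the convolution onto [g] and annihilates it. *)
Lemma tot_residual tau l n g x :
  (forall y, lfilter (flip l) (lfilter l g) y = 0) ->
  tot (fun y => residual tau l n y * g (x - y)) = g x.
Proof.
move=> Kg; elim: n => [|n IH].
  by rewrite (tot_impulse (fun y => g (x - y))) subr0.
have fr := fin_supp_residual tau l n.
rewrite -[RHS]IH/= -/(residual tau l n).
transitivity (tot (fun y => residual tau l n y * g (x - y) + (- tau) *
    (lfilter (flip l) (lfilter l (residual tau l n)) y * g (x - y)))).
  by congr tot; apply/funext => y; rewrite /relax; ring.
rewrite totD; last 2 first.
- exact: fin_supp_mull.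
- exact/fin_supp_mulr/fin_supp_mull/fin_supp_lfilter/fin_supp_lfilter.
rewrite totZ tot_lfilter_refl; last exact: fin_supp_lfilter.
rewrite tot_lfilter_refl// lfilter_comm.
under [X in _ + _ * tot X]eq_fun do rewrite Kg mulr0.
rewrite /tot [X in _ + _ * X]fsbig1 ?mulr0 ?addr0//.
Qed.

(** The geometric sum 1 - (1 - tau K)^n = tau K (1 + ... + (1 - tau K)^(n-1)), applied to the
    impulse. *)
Lemma residual_telescope tau l n x :
  lfilter (flip l) (lfilter l (fun y => tau * \sum_(k < n) residual tau l k y)) x
  = impulse x - residual tau l n x.
Proof.
have -> : lfilter l (fun y => tau * \sum_(k < n) residual tau l k y) =
    fun y => tau * \sum_(k < n) lfilter l (residual tau l k) y.
  by apply/funext => y; rewrite lfilterZ lfilter_sum.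
rewrite lfilterZ lfilter_sum; elim: n => [|n IH].
  by rewrite big_ord0 mulr0 /residual subrr.
by rewrite big_ord_recr/= mulrDr IH /relax; ring.
Qed.

Lemma cvg_sum_seq (I : Type) (r : seq I) (F : nat -> I -> R) (L : I -> R) :
  (forall i, F n i @[n --> \oo] --> L i) ->
  \sum_(i <- r) F n i @[n --> \oo] --> \sum_(i <- r) L i.
Proof.
move=> FL; elim: r => [|i r IH].
  by rewrite big_nil; under eq_cvg do rewrite big_nil; exact: cvg_cst.
rewrite big_cons; under eq_cvg do rewrite big_cons.
exact: cvgD.
Qed.

Lemma cvg_lfilter l (F : nat -> G -> R) g :
  (forall x, F n x @[n --> \oo] --> g x) ->
  forall x, lfilter l (F n) x @[n --> \oo] --> lfilter l g x.
Proof. by move=> Fg x; apply: cvg_sum_seq => p; apply: cvgMl_tmp; exact: Fg. Qed.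

(* Richardson iteration for the normal equation: the inverse of l applied to
   impulse is the l^2 limit of flip l applied to the Neumann sums. *)
Lemma l2_inverse l : coercive l ->
  exists psi C, lfilter l psi = impulse /\
    forall s : seq G, uniq s -> \sum_(x <- s) psi x ^+ 2 <= C.
Proof.
move=> cl; have [tau [rho [tau0 /andP[rho0 rho1] contr]]] := relax_contraction cl.
have [mu mu0 lmu] := cl; have [M M0 lM] := sqn_lfilter_bounded (flip l).
pose r := residual tau l; pose th := Num.sqrt rho.
have th1 : `|th| < 1 by rewrite ger0_norm ?sqrtr_ge0// -sqrtr1 ltr_sqrt.
(* A square sum of at most rho^n gives the pointwise bound th^n, so the Neumann series converges at
   every point. *)
have rle n x : `|r n x| <= th ^+ n.
  rewrite -sqrtr_sqr -(@ger0_norm _ (th ^+ n)) ?exprn_ge0 ?sqrtr_ge0//.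
  rewrite -(sqrtr_sqr (th ^+ n)) ler_sqrt ?sqr_ge0// exprAC sqr_sqrtr ?(ltW rho0)//.
  apply: le_trans (sqn_residual n (ltW rho0) contr).
  apply: (tot_ge (f := fun y => r n y ^+ 2)) => [|y]; last exact: sqr_ge0.
  exact/fin_suppX/fin_supp_residual.
pose gn n x := tau * \sum_(k < n) r k x.
have cvr x : cvgn (series (r^~ x)).
  apply: normed_cvg; apply: (@series_le_cvg _ _ (geometric 1 th)) => [n|n|n|].
  - exact: normr_ge0.
  - by rewrite /geometric/= mul1r exprn_ge0// sqrtr_ge0.
  - by rewrite /geometric/= mul1r.
  - exact: is_cvg_geometric_series.
pose g x := tau * limn (series (r^~ x)).
have gng x : gn n x @[n --> \oo] --> g x.
  apply: cvgMl_tmp; rewrite (_ : (fun n => _) = series (r^~ x)); first exact: cvr.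
  by apply/funext => n; rewrite /series/= big_mkord.
have fgn n : fin_supp (gn n).
  by apply: fin_supp_mulr; apply: fin_supp_sum => k; exact: fin_supp_residual.
(* K maps [gn n] to d = impulse - r n, and [sqn d] is at most 4. Then mu |gn|^2 <= <gn, d> and 2 mu
   <gn, d> <= mu^2 |gn|^2 + |d|^2 give mu^2 |gn|^2 <= 4. *)
pose C := 4 / mu ^+ 2.
have gnC n : sqn (gn n) <= C.
  have h := lmu _ (fgn n); have e0 : 0 < mu ^+ 2 by rewrite exprn_gt0.
  pose d x := impulse x + -1 * r n x.
  have fd : fin_supp d.
    by apply: fin_suppD; [exact: fin_supp_impulse | exact/fin_supp_mulr/fin_supp_residual].
  have d4 : sqn d <= 4.
    apply: le_trans (@sqnD_le _ _ 1 _ _ ltr01 fin_supp_impulse _) _.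
      exact/fin_supp_mulr/fin_supp_residual.
    rewrite sqnZ sqn_impulse invr1.
    have := le_trans (sqn_residual n (ltW rho0) contr) (exprn_ile1 n (ltW rho0) (ltW rho1)).
    by rewrite -/(r n); move: (sqn _) => u; lra.
  have ngd : 2 * mu * sqn (lfilter l (gn n)) <= mu ^+ 2 * sqn (gn n) + sqn d.
    rewrite -sqn_lfilter_flip// -totZ -sqnZ /sqn -totD; last 2 first.
    - exact/fin_suppX/fin_supp_mulr.
    - exact: fin_suppX.
    apply: ler_tot.
    - exact/fin_supp_mulr/fin_supp_mull.
    - by apply: fin_suppD; [exact/fin_suppX/fin_supp_mulr | exact: fin_suppX].
    move=> x; rewrite residual_telescope -/(r n) -subr_ge0.
    rewrite (_ : _ - _ = (mu * gn n x - d x) ^+ 2) ?sqr_ge0// /d.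
    by rewrite /gn; ring.
  rewrite /C ler_pdivlMr//; move: h; rewrite -(ler_pM2l mu0).
  by move: ngd d4; move: (sqn _) (sqn _) (sqn _) => u w z; lra.
pose psin n := lfilter (flip l) (gn n); exists (lfilter (flip l) g), (M * C).
have psing : forall x, psin n x @[n --> \oo] --> lfilter (flip l) g x.
  exact: cvg_lfilter.
split.
  rewrite lfilter_comm; apply/funext => x.
  have glim := @cvg_lfilter (flip l) _ _ (@cvg_lfilter l _ _ gng) x.
  have dlim : lfilter (flip l) (lfilter l (gn n)) x @[n --> \oo] --> impulse x.
    under eq_cvg do rewrite residual_telescope.
    suff : impulse x - r n x @[n --> \oo] --> impulse x - 0 by rewrite subr0.
    apply: cvgB; first exact: cvg_cst.
    apply: (@squeeze_cvgr _ _ _ _ (fun n => - th ^+ n) (fun n => th ^+ n)).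
    - by apply: nearW => n; rewrite -ler_norml.
    - by rewrite -oppr0; apply: cvgN; exact: cvg_expr.
    - exact: cvg_expr.
  exact: (cvg_unique _ glim dlim).
(* As in Fatou's lemma, a bound uniform in [n] passes to the limit on each finite [s]. *)
move=> s us; have slim : \sum_(x <- s) psin n x ^+ 2 @[n --> \oo] -->
    \sum_(x <- s) lfilter (flip l) g x ^+ 2.
  apply: (@cvg_sum_seq _ _ (fun n x => psin n x ^+ 2)) => x.
  by under eq_cvg do rewrite expr2; rewrite expr2; apply: cvgM.
apply: (cvgr_to_le slim).
apply: nearW => n; apply: (@le_trans _ _ (sqn (psin n))).
  apply: ler_sum_tot => // [|y]; last exact: sqr_ge0.
  exact/fin_suppX/fin_supp_lfilter.
apply: le_trans (lM _ (fgn n)) _.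
by rewrite ler_pM2l.
Qed.

End relaxation.

(** * Bounded solutions on the plane *)

Section planar_uniqueness.
Context (R : realType).
Implicit Types (f g : int * int -> R) (l : seq (R * (int * int))).

Definition in_box (n : nat) (x : int * int) := (`|x.1| <= n%:Z) && (`|x.2| <= n%:Z).

Definition box (n : nat) : seq (int * int) :=
  [seq (i%:Z - n%:Z, j%:Z - n%:Z) | i <- iota 0 (2 * n + 1), j <- iota 0 (2 * n + 1)].

Lemma mem_box n x : in_box n x -> x \in box n.
Proof.
case: x => i j /andP[/= ni nj]; apply/allpairsP.
exists (absz (i + n%:Z), absz (j + n%:Z)) => /=; split; rewrite ?mem_iota; try lia.
by congr (_, _); lia.
Qed.

Lemma uniq_box n : uniq (box n).
Proof.
apply: allpairs_uniq; rewrite ?iota_uniq// => -[i j] [i' j'] _ _ /= [ii jj].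
by congr (_, _); lia.
Qed.

Lemma size_box n : size (box n) = ((2 * n + 1) * (2 * n + 1))%N.
Proof. by rewrite size_allpairs !size_iota. Qed.

Definition box_supp n f := forall x, ~~ in_box n x -> f x = 0.

Lemma box_supp_lfilter n l f : all (fun p => in_box 1 p.2) l -> box_supp n f ->
  box_supp n.+1 (lfilter l f).
Proof.
move=> /allP l1 fn x nx; rewrite /lfilter big_seq big1// => -[k s] /l1/= s1.
rewrite fn ?mulr0//; apply: contra nx; move: x s s1 => [i j] [p q].
by rewrite /in_box/=; lia.
Qed.

Lemma all_in_box_flip l : all (fun p => in_box 1 p.2) l ->
  all (fun p => in_box 1 p.2) (flip l).
Proof.
by rewrite /flip all_map; apply: sub_all => -[k [i j]]; rewrite /in_box/= !normrN.
Qed.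

(** Each relaxation applies [l] and [flip l], and each of them widens the box by one. *)
Lemma box_supp_residual tau l n : all (fun p => in_box 1 p.2) l ->
  box_supp (2 * n) (residual tau l n).
Proof.
move=> l1; elim: n => [|n IH x nx].
  by move=> x; have [->|/impulse_eq0] := eqVneq x 0.
rewrite /residual/= -/(residual tau l n) /relax IH; last first.
  by apply: contra nx; rewrite /in_box; lia.
rewrite (@box_supp_lfilter (2 * n).+1) ?mulr0 ?subrr ?all_in_box_flip//.
  exact: box_supp_lfilter.
by apply: contra nx; rewrite /in_box; lia.
Qed.

(** Bernoulli's inequality for 1 / q = 1 + d. The factor 4 n + 1 is the side of [box (2 * n)]. *)
Lemma linear_geometric_bounded (q : R) : 0 < q < 1 ->
  exists2 C, 0 <= C & forall n : nat, (4 * n%:R + 1) * q ^+ n <= C.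
Proof.
move=> /andP[q0 q1]; pose d := q^-1 - 1.
have d0 : 0 < d by rewrite subr_gt0 invf_gt1.
have dn n : 1 + n%:R * d <= q^-1 ^+ n.
  elim: n => [|n IH]; first by rewrite mul0r addr0.
  have qd : q^-1 = 1 + d by rewrite addrC subrK.
  rewrite exprS {1}qd; move: IH; rewrite -(ler_pM2l (addr_gt0 ltr01 d0)).
  have := mulr_ge0 (ler0n R n) (sqr_ge0 d).
  by rewrite -natr1; move: (_ ^+ n) (n%:R) => u w; lra.
exists (4 / d + 1) => [|n]; first by rewrite addr_ge0// divr_ge0// ltW.
have := dn n; rewrite exprVn -[X in _ <= X]mul1r ler_pdivlMr ?exprn_gt0// => h.
apply: (@le_trans _ _ ((4 / d + 1) * ((1 + n%:R * d) * q ^+ n))); last first.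
  by rewrite ger_pMr// addr_gt0// divr_gt0.
rewrite mulrA ler_wpM2r ?exprn_ge0 ?(ltW q0)//.
rewrite (_ : _ * _ = 4 * n%:R + 1 + (4 / d + n%:R * d)); last by field; rewrite gt_eqF.
by rewrite lerDl addr_ge0 ?divr_ge0 ?mulr_ge0 ?ler0n// ltW.
Qed.

(* Kernel elements are fixed by the relaxation, hence by convolution with the
   residuals, whose l^1 norms tend to 0: they decay geometrically in l^2 and
   their supports grow polynomially. *)
Lemma bounded_kernel l g (B : R) :
  all (fun p => in_box 1 p.2) l -> coercive l ->
  (forall x, `|g x| <= B) ->
  (forall y, lfilter (flip l) (lfilter l g) y = 0) -> forall x, g x = 0.
Proof.
move=> l1 cl gB Kg x; have [tau [rho [tau0 /andP[rho0 rho1] contr]]] := relax_contraction cl.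
have B0 : 0 <= B by apply: le_trans (gB 0).
(* Of the four factors in rho^n = (q^n)^4, three form the weight [k] below: two absorb the (4 n +
   1)^2 points of the box, and one is left as decay. *)
pose q := Num.sqrt (Num.sqrt rho).
have q0 : 0 < q by rewrite !sqrtr_gt0.
have q1 : q < 1 by rewrite -sqrtr1 ltr_sqrt// -sqrtr1 ltr_sqrt.
have q4 : q ^+ 4 = rho by rewrite (exprM q 2 2) !sqr_sqrtr// ?sqrtr_ge0// ltW.
have [C C0 qC] := @linear_geometric_bounded q (introT andP (conj q0 q1)).
have main n : 2 * `|g x| <= B * (C ^+ 2 + 1) * q ^+ n.
  pose r := residual tau l n.
  have fr : fin_supp r := fin_supp_residual tau l n.
  have -> : g x = \sum_(y <- box (2 * n)) r y * g (x - y).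
    rewrite -tot_seq ?uniq_box// -(@tot_residual _ _ tau l n g x Kg).
    congr tot; apply/funext => y; case: ifP => // /negP yb.
    by rewrite box_supp_residual ?mul0r//; apply/negP => /mem_box.
  pose k := q ^+ n ^+ 3.
  have k0 : 0 < k by rewrite !exprn_gt0.
  (* By 2 |r| <= k + r^2 / k; over the box the first term sums to at most C^2 q^n and the second to
     at most rho^n / k = q^n. *)
  apply: (@le_trans _ _ (\sum_(y <- box (2 * n)) B * (k + k^-1 * r y ^+ 2))).
    apply: le_trans (ler_wpM2l _ (ler_norm_sum _ _ _)) _ => //.
    rewrite mulr_sumr; apply: ler_sum => y _; rewrite normrM mulrCA mulrC -mulrA.
    apply: (@le_trans _ _ (B * (2 * `|r y|))).
      by rewrite [`|g _| * _]mulrC [in leRHS]mulrC [leLHS]mulrA ler_wpM2l// mulr_ge0.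
    rewrite ler_wpM2l// -subr_ge0.
    rewrite (_ : _ - _ = k^-1 * (k - `|r y|) ^+ 2); last first.
      by rewrite -(real_normK (num_real (r y))); field; rewrite gt_eqF.
    by rewrite mulr_ge0 ?sqr_ge0// invr_ge0 ltW.
  rewrite -mulr_sumr -mulrA ler_wpM2l// big_split/=.
  have kE : k^-1 * rho ^+ n = q ^+ n.
    by rewrite -q4 exprAC /k (exprS _ 3) mulrCA mulVf ?mulr1// gt_eqF// exprn_gt0// exprn_gt0.
  rewrite mulrDl mul1r; apply: lerD; last first.
    rewrite -kE -mulr_sumr ler_pM2l ?invr_gt0//.
    apply: le_trans (sqn_residual n (ltW rho0) contr).
    apply: ler_sum_tot => [|y|]; [exact: fin_suppX | exact: sqr_ge0 | exact: uniq_box].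
  rewrite big_const_seq count_predT size_box iter_addr_0 -mulr_natl /k.
  rewrite exprSr mulrA ler_wpM2r ?exprn_ge0 ?(ltW q0)//.
  rewrite natrM natrD natrM natrM -expr2 -exprMn.
  rewrite ler_pXn2r// ?nnegrE//; first by rewrite mulrA -natrM; exact: qC.
  by rewrite mulr_ge0 ?exprn_ge0 ?(ltW q0)// addr_ge0// !mulr_ge0.
apply/normr0_eq0/le_anti; rewrite normr_ge0 andbT -(ler_pM2l (_ : 0 < 2))// mulr0.
have lim0 : geometric (B * (C ^+ 2 + 1)) q n @[n --> \oo] --> (0 : R).
  by apply: cvg_geometric; rewrite ger0_norm// ltW.
apply: (cvgr_to_ge lim0); apply: nearW => n; exact: main.
Qed.

End planar_uniqueness.

(** * Covariances and the Yule-Walker equations *)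

Section square_integrable.
Context (d : measure_display) (T : measurableType d) (R : realType)
  (P : probability T R).
Implicit Types (X Y Z : T -> R).

Lemma Lfun2_measurable X : X \in Lfun P 2%:E -> measurable_fun setT X.
Proof. by move=> /sub_Lfun_mfun; rewrite inE. Qed.

Lemma Lfun2_Lfun1 X : X \in Lfun P 2%:E -> X \in Lfun P 1.
Proof. by move=> ?; rewrite Lfun_subset12// fin_num_measure. Qed.

Lemma ae_eq_expectation X Y : measurable_fun setT X -> measurable_fun setT Y ->
  {ae P, forall w, X w = Y w} -> ('E_P[X] = 'E_P[Y])%E.
Proof.
move=> mX mY XY; rewrite !unlock; apply: ae_eq_integral => //.
- exact/measurable_EFinP.
- exact/measurable_EFinP.
- by apply: filterS XY => w -> _.
Qed.

Lemma ae_eq_covariance X X' Y Y' :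
  X \in Lfun P 2%:E -> X' \in Lfun P 2%:E ->
  Y \in Lfun P 2%:E -> Y' \in Lfun P 2%:E ->
  {ae P, forall w, X w = X' w} -> {ae P, forall w, Y w = Y' w} ->
  covariance P X Y = covariance P X' Y'.
Proof.
move=> X2 X'2 Y2 Y'2 XX' YY'.
have [mX mX'] := (Lfun2_measurable X2, Lfun2_measurable X'2).
have [mY mY'] := (Lfun2_measurable Y2, Lfun2_measurable Y'2).
rewrite !covarianceE ?Lfun2_mul_Lfun1 ?Lfun2_Lfun1//.
rewrite (ae_eq_expectation mX mX' XX') (ae_eq_expectation mY mY' YY').
congr (_ - _)%E; apply: ae_eq_expectation.
- exact: measurable_funM.
- exact: measurable_funM.
- by apply: filterS2 XX' YY' => w /= XX' YY'; rewrite /GRing.mul/= XX' YY'.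
Qed.

Definition rcov X Y := fine (covariance P X Y).

Lemma rcovC X Y : rcov X Y = rcov Y X.
Proof. by rewrite /rcov covarianceC. Qed.

Lemma EFin_rcov X Y : X \in Lfun P 2%:E -> Y \in Lfun P 2%:E ->
  (rcov X Y)%:E = covariance P X Y.
Proof. by move=> X2 Y2; rewrite fineK// covariance_fin_num ?Lfun2_mul_Lfun1 ?Lfun2_Lfun1. Qed.

Lemma Lfun2D X Y : X \in Lfun P 2%:E -> Y \in Lfun P 2%:E ->
  (fun w => X w + Y w) \in Lfun P 2%:E.
Proof. by move=> X2 Y2; apply: rpredD => //; rewrite lee1n. Qed.

Lemma Lfun2Z k X : X \in Lfun P 2%:E -> (fun w => k * X w) \in Lfun P 2%:E.
Proof.
move=> X2; rewrite (_ : (fun w => _) = k \o* X); first by rewrite Lfun_scale// ler1n.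
by apply/funext => w /=; rewrite mulrC.
Qed.

Lemma rcovDl X Y Z : X \in Lfun P 2%:E -> Y \in Lfun P 2%:E -> Z \in Lfun P 2%:E ->
  rcov (fun w => X w + Y w) Z = rcov X Z + rcov Y Z.
Proof.
move=> X2 Y2 Z2; apply: EFin_inj.
by rewrite EFinD !EFin_rcov ?Lfun2D// covarianceDl.
Qed.

Lemma rcovZl k X Z : X \in Lfun P 2%:E -> Z \in Lfun P 2%:E ->
  rcov (fun w => k * X w) Z = k * rcov X Z.
Proof.
move=> X2 Z2; apply: EFin_inj.
rewrite EFinM !EFin_rcov ?Lfun2Z// -covarianceZl ?Lfun2_mul_Lfun1 ?Lfun2_Lfun1//.
by congr covariance; apply/funext => w /=; rewrite mulrC.
Qed.

(** The variances of X + Y and X - Y are nonnegative. For a stationary field this bounds the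
    autocovariance by its value at 0. *)
Lemma rcov_norm_le X Y : X \in Lfun P 2%:E -> Y \in Lfun P 2%:E ->
  2 * `|rcov X Y| <= rcov X X + rcov Y Y.
Proof.
move=> X2 Y2.
have rcov0 k : 0 <= rcov X X + 2 * k * rcov X Y + k ^+ 2 * rcov Y Y.
  have : 0 <= rcov (fun w => X w + k * Y w) (fun w => X w + k * Y w).
    by apply: fine_ge0; exact: variance_ge0.
  have kY2 := Lfun2Z k Y2; have XY2 := Lfun2D X2 kY2.
  rewrite rcovDl// rcovZl// rcovC rcovDl// rcovZl// [X in _ + k * X]rcovC rcovDl// rcovZl//.
  by rewrite (rcovC Y X); move: (rcov _ _) (rcov _ _) (rcov _ _) => u w z; lra.
have := rcov0 1; have := rcov0 (-1).
have [?|?] := leP 0 (rcov X Y); [rewrite ger0_norm// | rewrite ltr0_norm//]; lra.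
Qed.

(** Both claims share one induction, since additivity of the covariance calls for square
    integrability of the tail. *)
Lemma rcov_lfilter (G : zmodType) (l : seq (R * G)) (X : G -> T -> R) Y x :
  (forall y, X y \in Lfun P 2%:E) -> Y \in Lfun P 2%:E ->
  (fun w => lfilter l (X^~ w) x) \in Lfun P 2%:E /\
  rcov (fun w => lfilter l (X^~ w) x) Y = lfilter l (fun y => rcov (X y) Y) x.
Proof.
move=> X2 Y2; elim: l => [|p l [IH2 IH]].
  rewrite (_ : (fun w => _) = cst 0); last by apply/funext => w; rewrite /lfilter big_nil.
  by rewrite Lfun_cst /rcov covariance_cst_l /lfilter big_nil.
rewrite (_ : (fun w => _) = (fun w => p.1 * X (x - p.2) w + lfilter l (X^~ w) x)).
  by rewrite Lfun2D ?Lfun2Z// rcovDl ?Lfun2Z// rcovZl// lfilter_cons IH.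
by apply/funext => w; rewrite lfilter_cons.
Qed.

End square_integrable.

Section yule_walker.
Context (R : realType).

Definition quadrant_op (a b c : R) : seq (R * (int * int)) :=
  ar_op a b c (1, 0) (0, 1).

Lemma quadrant_opE a b c (f : int * int -> R) i j :
  lfilter (quadrant_op a b c) f (i, j) =
  f (i, j) - a * f (i - 1, j) - b * f (i, j - 1) - c * f (i - 1, j - 1).
Proof.
have subE (p q : int) : (i, j) - (p, q) = (i - p, j - q) by [].
rewrite /quadrant_op /ar_op /lfilter !big_cons big_nil /= mul1r !mulNr !addrA.
by rewrite addr0 (_ : (1, 0) + (0, 1) = (1, 1))// !subE !subr0.
Qed.

(** The filtered field [W] is almost surely the noise, so its covariances are known; expanding them
    produces [l] from the first argument and [flip l] from the second. *)
Lemma yule_walker (a b c v : R) gamma : is_autocov (a, b, c, v) gamma ->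
  let g (x : int * int) := gamma x.1 x.2 in
  (forall x, `|g x| <= g 0) /\
  (forall x, lfilter (flip (quadrant_op a b c)) (lfilter (quadrant_op a b c) g) x
     = v * impulse R x).
Proof.
move=> [d [T [P [X [eps [[eps2 _ epsV eps0] [X2 _ Xcov] ar]]]]]] g.
pose l := quadrant_op a b c.
pose Xf (x : int * int) := X x.1 x.2.
have Xf2 x : Xf x \in Lfun P 2%:E by exact: X2.
have gE x y : rcov P (Xf x) (Xf y) = g (x - y).
  have := Xcov x.1 x.2 (x - y).1 (x - y).2.
  by rewrite /rcov (subKr x.1 y.1) (subKr x.2 y.2) => ->.
split => [x|x].
  have := rcov_norm_le (Xf2 x) (Xf2 0); rewrite !gE !subrr subr0; lra.
pose W y w := lfilter l (Xf^~ w) y.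
have W2 y : W y \in Lfun P 2%:E by case: (@rcov_lfilter _ _ _ P _ l Xf (Xf 0) y Xf2 (Xf2 0)).
have epsW y : {ae P, forall w, eps y.1 y.2 w = W y w}.
  case: y => i j; apply: filterS (ar i j) => w.
  by rewrite /W quadrant_opE /Xf/= => ->; ring.
have WE y z : rcov P (W y) (W z) = rcov P (eps y.1 y.2) (eps z.1 z.2).
  by congr fine; apply/esym/ae_eq_covariance.
have W0 : rcov P (W x) (W 0) = v * impulse R x.
  rewrite WE /rcov /impulse; have [->|x0] := eqVneq x 0.
    by have := epsV 0 0; rewrite /variance => -> /=; rewrite mulr1.
  by rewrite eps0 ?mulr0//; case: (x) x0.
rewrite -W0 /W (@rcov_lfilter _ _ _ P _ l Xf (W 0) x Xf2 (W2 0)).2 lfilter_comm.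
congr (lfilter l _ x); apply/funext => y.
rewrite rcovC /W (@rcov_lfilter _ _ _ P _ l Xf (Xf y) 0 Xf2 (Xf2 y)).2.
rewrite /lfilter big_map; apply: eq_bigr => -[k s] _ /=.
by rewrite rcovC gE sub0r.
Qed.

End yule_walker.

(** * Existence of the stationary field *)

Section coin.
Context (R : realType).

(** A discrete space of fair signs: [n.*2] and [n.*2.+1] each have mass 2^-(n+2). White noise has to
    be uncorrelated only, so functions that are odd on each pair suffice to build it. *)
Definition coin : set nat -> \bar R :=
  mseries (fun n => mscale (2^-1 ^+ n.+2)%:nng
    (measure_add (\d_(n.*2) : {measure set nat -> \bar R}) \d_(n.*2.+1))) 0.

HB.instance Definition _ := Measure.on coin.

Lemma ge0_integral_coin (F : nat -> \bar R) : (forall m, 0 <= F m)%E ->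
  (\int[coin]_m F m =
   \sum_(n <oo) ((2^-1 ^+ n.+2)%:E * (F n.*2 + F n.*2.+1)))%E.
Proof.
move=> F0; rewrite /coin ge0_integral_measure_series//.
apply: eq_eseriesr => n _; rewrite ge0_integral_mscale//.
by rewrite ge0_integral_measure_add// !integral_dirac// !diracT !mul1e.
Qed.

Lemma coin_setT : coin setT = 1%E.
Proof.
transitivity (\int[coin]_m (cst 1 m))%E; first by rewrite integral_cst// mul1e.
rewrite ge0_integral_coin//=.
have := @cvg_geometric_eseries_half R 1 0.
rewrite expr0 divr1 => /cvg_lim h; rewrite -[RHS]h//.
apply/congr_lim/funext => n; apply: eq_bigr => k _.
rewrite -EFinD -EFinM addn1 div1r natrX exprSr exprVn.
by rewrite -mulrA (_ : 2^-1 * (1 + 1) = 1) ?mulr1// mulVf.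
Qed.

HB.instance Definition _ := Measure_isProbability.Build _ _ _ coin coin_setT.

Lemma sqr_integrable_Lfun2 (X : nat -> R) :
  (\int[coin]_m (X m ^+ 2)%:E < +oo)%E -> X \in Lfun coin 2%:E.
Proof.
move=> X2; rewrite inE; apply/andP; split; rewrite inE//=.
rewrite /finite_norm unlock poweR_lty//.
under eq_integral => m _ do rewrite /= powR_mulrn// real_normK ?num_real//.
exact: X2.
Qed.

(** Oddness exchanges the positive and the negative part within each pair, whose two points have
    equal mass. *)
Lemma expectation_odd (X : nat -> R) : X \in Lfun coin 1 ->
  (forall n, X n.*2.+1 = - X n.*2) -> ('E_coin[X] = 0)%E.
Proof.
move=> /Lfun1_integrable iX oddX; rewrite unlock integralE.
have -> : (\int[coin]_x (fun w => (X w)%:E)^\- x =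
           \int[coin]_x (fun w => (X w)%:E)^\+ x)%E.
  rewrite !ge0_integral_coin//.
  apply: eq_eseriesr => n _; congr (_ * _)%E.
  by rewrite !funeposE !funenegE !oddX -!EFinN opprK addeC.
by rewrite subee// integrable_pos_fin_num.
Qed.

End coin.

(** * The isometry from square-summable functions to random variables *)

Section white_noise_space.
Context (R : realType) (G : zmodType) (e : nat -> G) (bij_e : set_bij setT setT e).
Implicit Types f g : G -> R.

Local Notation coin := (@coin R).

Definition sqsum f : \bar R := \esum_(x in [set: G]) (f x ^+ 2)%:E.

(* The factor is the inverse square root of the mass of the pair {2n, 2n+1},
   which makes embed isometric; the sign makes its values centered. *)
Definition embed f (m : nat) : R :=
  (-1) ^+ m * (Num.sqrt (2 ^+ m./2.+1) * f (e m./2)).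

Lemma embed_sqr f m : embed f m ^+ 2 = 2 ^+ m./2.+1 * f (e m./2) ^+ 2.
Proof. by rewrite /embed exprMn sqrr_sign mul1r exprMn sqr_sqrtr// exprn_ge0. Qed.

Lemma half_doubleS n : n.*2.+1./2 = n.
Proof. by rewrite -[n.*2.+1]/(true + n.*2)%N half_bit_double. Qed.

Lemma integral_embed f : (\int[coin]_m (embed f m ^+ 2)%:E = sqsum f)%E.
Proof.
rewrite ge0_integral_coin => [|m]; last by rewrite lee_fin sqr_ge0.
rewrite /sqsum (reindex_esum setT _ e)// -nneseries_esumT => [|m]; last first.
  by rewrite lee_fin sqr_ge0.
apply: eq_eseriesr => n _; rewrite !embed_sqr half_doubleS doubleK -EFinD -EFinM.
congr EFin; set F := f (e n) ^+ 2.
rewrite (_ : _ + _ = 2 ^+ n.+2 * F); last by rewrite (exprS _ n.+1); ring.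
by rewrite mulrA -exprMn mulVf ?expr1n ?mul1r.
Qed.

Definition l2 f := (sqsum f < +oo)%E.

Lemma embed_Lfun2 f : l2 f -> embed f \in Lfun coin 2%:E.
Proof. by move=> f2; apply: sqr_integrable_Lfun2; rewrite integral_embed. Qed.

Lemma expectation_embed f : l2 f -> ('E_coin[embed f] = 0)%E.
Proof.
move=> /embed_Lfun2/Lfun2_Lfun1 f1; apply: expectation_odd => // n.
by rewrite /embed half_doubleS doubleK exprS mulN1r mulNr.
Qed.

Lemma variance_embed f : l2 f -> ('V_coin[embed f] = sqsum f)%E.
Proof.
move=> f2; rewrite varianceE ?embed_Lfun2// expectation_embed//.
by rewrite expe2 mule0 sube0 unlock -integral_embed.
Qed.

Lemma rcov_embed f : l2 f -> rcov coin (embed f) (embed f) = fine (sqsum f).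
Proof. by move=> f2; rewrite -(variance_embed f2). Qed.

Lemma embedD f g : embed (fun x => f x + g x) = fun m => embed f m + embed g m.
Proof. by apply/funext => m; rewrite /embed; ring. Qed.

(** Closure under sums is inherited from L^2 of [coin] through the isometry [embed]. *)
Lemma l2D f g : l2 f -> l2 g -> l2 (fun x => f x + g x).
Proof.
move=> f2 g2; rewrite /l2 -integral_embed embedD.
have := Lfun2D (embed_Lfun2 f2) (embed_Lfun2 g2).
move=> /Lfun2_integrable_sqr/integrableP[_]; apply: le_lt_trans.
rewrite le_eqVlt; apply/orP; left; apply/eqP; apply: eq_integral => m _ /=.
by rewrite ger0_norm// sqr_ge0.
Qed.

(** Polarization: covariances reduce to square sums, which are easy to translate and reflect. *)
Lemma rcov_embed2 f g : l2 f -> l2 g -> 2 * rcov coin (embed f) (embed g) =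
  fine (sqsum (fun x => f x + g x)) - fine (sqsum f) - fine (sqsum g).
Proof.
move=> f2 g2; rewrite -!rcov_embed ?l2D// embedD.
have [F2 G2] := (embed_Lfun2 f2, embed_Lfun2 g2); have FG2 := Lfun2D F2 G2.
pose S m := embed f m + embed g m.
rewrite rcovDl// -/S (rcovC coin (embed f) S) (rcovC coin (embed g) S) !rcovDl//.
by rewrite (rcovC coin (embed g) (embed f)); ring.
Qed.

Lemma rcov_embed_disjoint f g : l2 f -> l2 g -> (forall x, f x * g x = 0) ->
  rcov coin (embed f) (embed g) = 0.
Proof.
move=> f2 g2 fg; have [F2 G2] := (embed_Lfun2 f2, embed_Lfun2 g2).
rewrite /rcov (covarianceE (Lfun2_Lfun1 F2) (Lfun2_Lfun1 G2) (Lfun2_mul_Lfun1 F2 G2)).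
rewrite !expectation_embed// mule0 sube0 (_ : _ * _ = cst 0) ?expectation_cst//.
apply/funext => m /=; rewrite /GRing.mul/= /embed.
have /eqP := fg (e m./2); rewrite mulf_eq0.
by case/orP => /eqP ->; rewrite !(mulr0, mul0r).
Qed.

Lemma sqsum_reflect f s : sqsum (fun x => f (s - x)) = sqsum f.
Proof.
rewrite [RHS]/sqsum (reindex_esum setT _ (fun x => s - x))//.
rewrite setTT_bijective; exists (fun x => s - x) => x; exact: subKr.
Qed.

Lemma sqsum_impulse k s : sqsum (fun x => k * impulse R (s - x)) = (k ^+ 2)%:E.
Proof.
rewrite (sqsum_reflect (fun x => k * impulse R x)) /sqsum.
have -> : k ^+ 2 = (k * impulse R (0 : G)) ^+ 2 by rewrite /impulse eqxx mulr1.
rewrite -(@esum_set1 _ _ 0 (fun x : G => ((k * impulse R x) ^+ 2)%:E)); last first.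
  by rewrite lee_fin sqr_ge0.
rewrite [in RHS]esum_mkcond; apply: eq_esum => x _.
case: ifPn => //. rewrite notin_setE /= => /eqP/impulse_eq0 ->.
by rewrite mulr0 expr0n.
Qed.


Lemma l2_of_bounded f (C : R) :
  (forall s : seq G, uniq s -> \sum_(x <- s) f x ^+ 2 <= C) -> l2 f.
Proof.
move=> fC; apply: (@le_lt_trans _ _ C%:E); last exact: ltry.
apply: ge_ereal_sup => _ [A [finA _] <-].
rewrite fsbig_finite//= sumEFin lee_fin; apply: fC.
exact: finmap.fset_uniq.
Qed.

Lemma l2Z k f : l2 f -> l2 (fun x => k * f x).
Proof.
move=> f2; rewrite /l2 -integral_embed.
rewrite (_ : embed _ = fun m => k * embed f m); last first.
  by apply/funext => m; rewrite /embed; ring.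
have := Lfun2Z k (embed_Lfun2 f2).
move=> /Lfun2_integrable_sqr/integrableP[_]; apply: le_lt_trans.
rewrite le_eqVlt; apply/orP; left; apply/eqP; apply: eq_integral => m _ /=.
by rewrite ger0_norm// sqr_ge0.
Qed.

End white_noise_space.

(** * The moving-average solution of the recursion *)

Section existence.
Context (R : realType).

Lemma int2_enum : exists e : nat -> int * int, set_bij setT setT e.
Proof.
have /card_set_bijP[f] : ([set: int * int] #= [set: nat])%card; last first.
  by rewrite setTT_bijective => -[e fK eK]; exists e; rewrite setTT_bijective; exists f.
apply: eq_card_nat; first exact: countableP.
move=> /(finite_image (fun x => absz x.1)); rewrite (_ : _ @` _ = setT).
  exact: infinite_nat.
by apply/seteqP; split => // n _; exists (n%:Z, 0).
Qed.

Lemma autocov_exists (a b c v : R) : 0 < v -> coercive (quadrant_op a b c) ->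
  exists gamma, is_autocov (a, b, c, v) gamma.
Proof.
move=> v0 /l2_inverse[psi [C [psiP psiC]]]; have [e bij_e] := int2_enum.
pose sv := Num.sqrt v; pose G := (int * int)%type.
have sv2 : sv ^+ 2 = v by rewrite sqr_sqrtr// ltW.
(* The coefficients of X_p and eps_p over the orthonormal family indexed by the plane; [sv] sets the
   variance of the noise. *)
pose fX (p x : G) := sv * psi (p - x); pose feps (p x : G) := sv * impulse R (p - x).
have psi2 : l2 psi := l2_of_bounded psiC.
have fX2 p : l2 (fX p).
  by apply: (l2Z bij_e); rewrite /l2 sqsum_reflect.
have feps2 p : l2 (feps p) by rewrite /l2 sqsum_impulse ltry.
pose X i j := embed e (fX (i, j)); pose eps i j := embed e (feps (i, j)).
pose gamma h1 h2 := rcov (coin R) (X h1 h2) (X 0 0).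
(* Stationarity: after the reflection x -> p - x the polarization formula depends on p - q alone. *)
have rcovX p q : 2 * rcov (coin R) (embed e (fX p)) (embed e (fX q)) =
    fine (sqsum (fun x => sv * psi x + sv * psi (x - (p - q))))
    - fine (sqsum (fun x => sv * psi x)) - fine (sqsum (fun x => sv * psi x)).
  rewrite rcov_embed2//; pose H x := sv * psi x + sv * psi (x - (p - q)).
  rewrite (_ : (fun x => _) = fun x => H (p - x)); last first.
    apply/funext => x; rewrite /fX /H; congr (_ + _ * psi _).
    by rewrite opprB addrCA [p - x]addrC addrK.
  rewrite (sqsum_reflect H) (sqsum_reflect (fun x => sv * psi x) p).
  by rewrite (sqsum_reflect (fun x => sv * psi x) q).
exists gamma, _, nat, (coin R), X, eps; split.
- split => [i j|i j|i j|i j k l ijkl].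
  + exact: embed_Lfun2.
  + exact: expectation_embed.
  + by rewrite variance_embed// sqsum_impulse sv2.
  + rewrite -EFin_rcov ?embed_Lfun2// rcov_embed_disjoint// => x.
    rewrite /feps; have [<-|] := eqVneq (i, j) x.
      by rewrite (@impulse_eq0 _ _ ((k, l) - _)) ?mulr0// subr_eq0 eq_sym.
    by rewrite -subr_eq0 => /impulse_eq0 ->; rewrite mulr0 mul0r.
- split => [i j||i j h1 h2].
  + exact: embed_Lfun2.
  + by exists 0 => i j; exact: expectation_embed.
  + rewrite -EFin_rcov ?embed_Lfun2//; congr EFin; rewrite /gamma /X.
    apply: (@mulfI _ 2); rewrite ?pnatr_eq0// !rcovX.
    by rewrite subr0 (_ : (i, j) - (i - h1, j - h2) = (h1, h2))// ; congr (_, _); rewrite /= subKr.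
(* The recursion holds at every sample point [m]: it is the equation for [psi] at (i, j) - e m./2,
   up to a common factor. *)
move=> i j; apply: aeW => m; rewrite /X /eps /embed /fX /feps.
have := congr1 (fun f => f ((i, j) - e m./2)) psiP.
case: (e m./2) => p q; rewrite (quadrant_opE a b c psi (i - p) (j - q)) => <-.
have shift (x y : int) : x - 1 - y = x - y - 1 by rewrite addrAC.
have subE (x y : int) : (x, y) - (p, q) = (x - p, y - q) by [].
by rewrite !subE !shift; ring.
Qed.

End existence.

(** * The symbol of the autocovariance *)

Section symbol.
Context (R : realType).
Implicit Types (a b c v : R) (t : param R).

(** The four factors in [Theta] multiply to (E - 2 F)(E + 2 F), with E = 1 + a^2 - b^2 - c^2 and F =
    a + b c. *)
Lemma Theta_coercive a b c v : Theta (a, b, c, v) -> coercive (quadrant_op a b c).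
Proof.
move=> [Th _]; apply: coercive_ar_op; rewrite -subr_gt0.
by move: Th; congr (0 < _); ring.
Qed.

(** Existence keeps [xget] away from its default value. *)
Lemma autocovP t : Theta t -> is_autocov t (autocov t).
Proof.
case: t => [[[a b] c] v] /[dup] Th [_ v0].
have [gamma ?] := autocov_exists v0 (Theta_coercive Th).
exact: (@xgetPex _ _ [set gamma | is_autocov (a, b, c, v) gamma]) (ex_intro _ gamma _).
Qed.

Definition gram_op a b c (f : int * int -> R) :=
  lfilter (flip (quadrant_op a b c)) (lfilter (quadrant_op a b c) f).

Lemma gram_opE a b c f i j : gram_op a b c f (i, j) =
  (1 + a ^+ 2 + b ^+ 2 + c ^+ 2) * f (i, j)
  - (a - b * c) * (f (i - 1, j) + f (i + 1, j))
  - (b - a * c) * (f (i, j - 1) + f (i, j + 1))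
  - c * (f (i - 1, j - 1) + f (i + 1, j + 1))
  + a * b * (f (i - 1, j + 1) + f (i + 1, j - 1)).
Proof.
have subE (p q : int) : (i, j) - (p, q) = (i - p, j - q) by [].
rewrite /gram_op {1}/lfilter big_map /quadrant_op /ar_op !big_cons big_nil /=.
rewrite -/(quadrant_op a b c) (_ : (1, 0) + (0, 1) = (1, 1))//.
have addE (p q : int) : (i, j) - - (p, q) = (i + p, j + q) by rewrite opprK.
rewrite !addE !addr0.
rewrite !quadrant_opE !addrK; ring.
Qed.

(** Equality of K / v and K' / v', cleared of denominators. K is invariant under x -> -x, so its
    nine coefficients reduce to the central one and four pairs. *)
Definition same_symbol t t' :=
  let: (a, b, c, v) := t in let: (a', b', c', v') := t' in
  [/\ v' * (1 + a ^+ 2 + b ^+ 2 + c ^+ 2) = v * (1 + a' ^+ 2 + b' ^+ 2 + c' ^+ 2),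
      v' * (a - b * c) = v * (a' - b' * c'),
      v' * (b - a * c) = v * (b' - a' * c'),
      v' * c = v * c' &
      v' * (a * b) = v * (a' * b')].

Lemma autocov_eqP t t' : Theta t -> Theta t' ->
  autocov t = autocov t' <-> same_symbol t t'.
Proof.
move: t t' => [[[a b] c] v] [[[a' b'] c'] v'] Th Th'.
have [gB Kg] := yule_walker (autocovP Th).
have [gB' Kg'] := yule_walker (autocovP Th').
move: gB gB' Kg Kg'; set g := fun x => autocov (a, b, c, v) x.1 x.2.
set g' := fun x => autocov (a', b', c', v') x.1 x.2 => gB gB' Kg Kg'.
have [[_ v0] [_ v'0]] := (Th, Th').
split=> [gg'|].
  have {}gg' : g' = g by rewrite /g /g' gg'.
  (* K K' g is computed in both orders, each time with the Yule-Walker equation for the inner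
     operator. *)
  have KK x : v * gram_op a' b' c' (@impulse R _) x = v' * gram_op a b c (@impulse R _) x.
    transitivity (gram_op a' b' c' (gram_op a b c g) x).
      rewrite /gram_op (_ : lfilter (flip (quadrant_op a b c)) _ =
        fun y => v * impulse R y); last first.
        by apply/funext.
      rewrite -lfilterZ; congr (lfilter _ _ x); apply/funext => y.
      by rewrite lfilterZ.
    transitivity (gram_op a b c (gram_op a' b' c' g) x).
      rewrite /gram_op (lfilter_comm (quadrant_op a' b' c')) (lfilter_comm (flip _)).
      congr (lfilter _ _ x); rewrite (lfilter_comm (quadrant_op a' b' c')).
      by rewrite (lfilter_comm (flip _)).
    rewrite {2}/gram_op -gg' (_ : lfilter (flip (quadrant_op a' b' c')) _ =
      fun y => v' * impulse R y); last first.
      by apply/funext.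
    rewrite /gram_op -lfilterZ; congr (lfilter _ _ x); apply/funext => y.
    by rewrite lfilterZ.
  (* One lattice point for each of the five coefficients. *)
  have h00 := KK (0, 0); have h10 := KK (1, 0); have h01 := KK (0, 1).
  have h11 := KK (1, 1); have hm := KK (1, -1).
  move: h00 h10 h01 h11 hm; rewrite !gram_opE /impulse /=.
  by move=> h00 h10 h01 h11 hm; split; lra.
case=> e1 e2 e3 e4 e5.
have KE f x : v' * gram_op a b c f x = v * gram_op a' b' c' f x.
  case: x => i j; rewrite !gram_opE; move: (f _) (f _ + f _) (f _ + f _) (f _ + f _) (f _ + f _).
  move=> f0 f1 f2 f3 f4.
  rewrite !mulrDr !mulrN !mulrA -(mulrA v' a b) -(mulrA v a' b').
  by rewrite e1 e2 e3 e4 e5.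
(* Conversely, the difference of the autocovariances is bounded and lies in the kernel of K, hence
   vanishes. *)
pose dg x := g x + -1 * g' x.
have dgB x : `|dg x| <= g 0 + g' 0.
  apply: le_trans (ler_normD _ _) _.
  by rewrite mulN1r normrN lerD ?gB ?gB'.
have Kdg x : gram_op a b c dg x = 0.
  rewrite /gram_op (_ : lfilter (quadrant_op a b c) dg = fun y =>
    lfilter (quadrant_op a b c) g y + -1 * lfilter (quadrant_op a b c) g' y); last first.
    by apply/funext => y; rewrite lfilterD lfilterZ.
  rewrite lfilterD lfilterZ -!/(gram_op a b c _ x) [X in X + _]Kg.
  have : v' * gram_op a b c g' x = v * (v' * impulse R x) by rewrite KE [X in _ * X]Kg'.
  rewrite mulrCA => /mulfI -> //; last by rewrite gt_eqF.
  by rewrite mulN1r subrr.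
have dg0 := bounded_kernel _ (Theta_coercive Th) dgB Kdg.
apply/funext => h1; apply/funext => h2; apply/eqP; rewrite -subr_eq0 -mulN1r.
by apply/eqP/(dg0 _ (h1, h2)).
Qed.

End symbol.

(** * The classes *)

From mathcomp Require Import finmap.

Section classes.
Context (R : realType).
Implicit Types (a b c v w : R) (t : param R).

(** The squares leave two independent signs; the mixed product ties them together because [E] is
    nonzero. *)
Lemma eq_up_to_sign (E F E' F' w : R) : E != 0 ->
  E' ^+ 2 = w ^+ 2 * E ^+ 2 -> E' * F' = w ^+ 2 * (E * F) ->
  F' ^+ 2 = w ^+ 2 * F ^+ 2 ->
  (E' = w * E /\ F' = w * F) \/ (E' = - (w * E) /\ F' = - (w * F)).
Proof.
move=> E0 EE EF FF; have [w0|w0] := eqVneq w 0.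
  left; move: EE FF; rewrite w0 expr0n !mul0r.
  by move=> /eqP + /eqP; rewrite !sqrf_eq0 => /eqP -> /eqP ->.
have wE0 : w * E != 0 by rewrite mulf_neq0.
have /eqP : E' ^+ 2 = (w * E) ^+ 2 by rewrite EE exprMn.
rewrite eqf_sqr => /orP[] /eqP E'E; [left|right]; split=> //; apply: (mulfI wE0).
- by rewrite -{1}E'E EF; ring.
- by apply: oppr_inj; rewrite -mulNr -E'E EF; ring.
Qed.

(* The discriminant of |1 - a z - b w - c z w|^2 as a quadratic in w is the
   square of E - F (z + 1/z), so the symbol determines E and F up to sign. *)
Lemma split_symbol (a b c a' b' c' w : R) :
  4 * (a + b * c) ^+ 2 < (1 + a ^+ 2 - b ^+ 2 - c ^+ 2) ^+ 2 ->
  w * (1 + a ^+ 2 + b ^+ 2 + c ^+ 2) = 1 + a' ^+ 2 + b' ^+ 2 + c' ^+ 2 ->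
  w * (a - b * c) = a' - b' * c' -> w * (b - a * c) = b' - a' * c' ->
  w * c = c' -> w * (a * b) = a' * b' ->
  [/\ a' = w * a, b' * c' = w * (b * c), 1 + a' ^+ 2 = w * (1 + a ^+ 2) &
      b' ^+ 2 + c' ^+ 2 = w * (b ^+ 2 + c ^+ 2)] \/
  [/\ a' = - (w * (b * c)), b' * c' = - (w * a), 1 + a' ^+ 2 = w * (b ^+ 2 + c ^+ 2) &
      b' ^+ 2 + c' ^+ 2 = w * (1 + a ^+ 2)].
Proof.
move=> lt e1 e2 e3 e4 e5.
pose E a b c : R := 1 + a ^+ 2 - b ^+ 2 - c ^+ 2; pose F a b c : R := a + b * c.
(* The coefficients of (E - F (z + 1/z))^2, written through those quantities that the hypotheses
   compare. *)
have E2 a0 b0 c0 : E a0 b0 c0 ^+ 2 = (1 + a0 ^+ 2 + b0 ^+ 2 + c0 ^+ 2) ^+ 2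
    - 4 * ((b0 - a0 * c0) ^+ 2 + (c0 + a0 * b0) ^+ 2) by rewrite /E; ring.
have EF a0 b0 c0 : E a0 b0 c0 * F a0 b0 c0 =
    (1 + a0 ^+ 2 + b0 ^+ 2 + c0 ^+ 2) * (a0 - b0 * c0)
    + 2 * (b0 - a0 * c0) * (c0 - a0 * b0) by rewrite /E /F; ring.
have F2 a0 b0 c0 : F a0 b0 c0 ^+ 2 = (a0 - b0 * c0) ^+ 2 + 4 * c0 * (a0 * b0).
  by rewrite /F; ring.
have E0 : E a b c != 0.
  apply/eqP => E0; move: lt; rewrite -/(E a b c) E0 expr0n ltNge mulr_ge0 ?sqr_ge0//.
have h1 : E a' b' c' ^+ 2 = w ^+ 2 * E a b c ^+ 2.
  by rewrite !E2 -e1 -e3 -e4 -e5; ring.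
have h2 : E a' b' c' * F a' b' c' = w ^+ 2 * (E a b c * F a b c).
  by rewrite !EF -e1 -e2 -e3 -e4 -e5; ring.
have h3 : F a' b' c' ^+ 2 = w ^+ 2 * F a b c ^+ 2.
  by rewrite !F2 -e2 -e4 -e5; ring.
(* Up to the factor w, the sign + preserves |1 - a z|^2 and |b + c z|^2 on the unit circle, and the
   sign - exchanges them. *)
have := eq_up_to_sign E0 h1 h2 h3; rewrite /E /F.
by case=> -[hE hF]; [left|right]; split; lra.
Qed.

(** [split_symbol] is applied twice, the second time with [a] and [b] exchanged. Of the four sign
    pairs, ++ gives the parameter itself, -- the generic partner, and a mixed pair the parameter
    itself or the inversion of one coefficient. *)
Lemma same_symbol_cases (a b c v a' b' c' v' : R) :
  Theta (a, b, c, v) -> Theta (a', b', c', v') ->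
  same_symbol (a, b, c, v) (a', b', c', v') ->
  [\/ (a', b', c', v') = (a, b, c, v),
      c != 0 /\ (a', b', c', v') = (- b / c, - a / c, 1 / c, c ^- 2 * v),
      [/\ c = - (a * b), a != 0 &
        (a', b', c', v') = (a^-1, b, - (a^-1 * b), a ^- 2 * v)] |
      [/\ c = - (a * b), b != 0 &
        (a', b', c', v') = (a, b^-1, - (a * b^-1), b ^- 2 * v)]].
Proof.
move=> [Th v0] [_ v'0] [e1 e2 e3 e4 e5].
pose w := v' / v; have w0 : 0 < w by rewrite divr_gt0.
have v'E : v' = w * v by rewrite /w divfK// gt_eqF.
have {v'0} div x y : v' * x = v * y -> w * x = y.
  by rewrite v'E mulrAC mulrC => /mulfI -> //; rewrite gt_eqF.
move: {e1 e2 e3 e4 e5}(div _ _ e1) (div _ _ e2) (div _ _ e3) (div _ _ e4) (div _ _ e5).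
move=> e1 e2 e3 e4 e5.
have ThE : 4 * (a + b * c) ^+ 2 < (1 + a ^+ 2 - b ^+ 2 - c ^+ 2) ^+ 2.
  by rewrite -subr_gt0; move: Th; congr (0 < _); ring.
have ThG : 4 * (b + a * c) ^+ 2 < (1 + b ^+ 2 - a ^+ 2 - c ^+ 2) ^+ 2.
  by rewrite -subr_gt0; move: Th; congr (0 < _); ring.
have e1' : w * (1 + b ^+ 2 + a ^+ 2 + c ^+ 2) = 1 + b' ^+ 2 + a' ^+ 2 + c' ^+ 2.
  by rewrite (addrAC 1 (b' ^+ 2)) -e1; ring.
have e5' : w * (b * a) = b' * a' by rewrite mulrC [RHS]mulrC -e5 mulrC [b * a]mulrC.
have hA := split_symbol ThE e1 e2 e3 e4 e5.
have hB := split_symbol ThG e1' e3 e2 e4 e5'.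
have invE x : w * x ^+ 2 = 1 -> x != 0 /\ w = x ^- 2.
  move=> wx; have x0 : x != 0.
    by apply/eqP => x0; move: wx; rewrite x0 expr0n mulr0 => /esym/eqP; rewrite oner_eq0.
  by split=> //; rewrite -[RHS]mul1r -wx mulfK// sqrf_eq0.
(* Substituting x' = w x turns the other equation into (w - 1) (1 - w x^2) = 0. *)
have one x x' : x' = w * x -> 1 + x' ^+ 2 = w * (1 + x ^+ 2) ->
    w = 1 \/ w * x ^+ 2 = 1.
  move=> -> h; have /eqP : (w - 1) * (1 - w * x ^+ 2) = 0 by move: h; lra.
  by rewrite mulf_eq0 !subr_eq0 => /orP[/eqP|/eqP <-]; [left|right].
have id1 : w = 1 -> a' = w * a -> b' = w * b -> (a', b', c', v') = (a, b, c, v).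
  by move=> w1; rewrite v'E -e4 w1 !mul1r => -> ->.
case: hA hB => -[a1 a2 a3 a4] [] [b1 b2 b3 b4].
- have [w1|wa] := one _ _ a1 a3; first by apply: Or41; exact: id1.
  have [w1|wb] := one _ _ b1 b3; first by apply: Or41; exact: id1.
  (* Here w a^2 = w b^2 = 1, so w a b is nonzero and w a b = (w a) (w b) forces w = 1. *)
  apply: Or41; apply: id1 => //; move: e5; rewrite a1 b1.
  have [a0 _] := invE _ wa; have [b0 _] := invE _ wb => e5.
  have wab : w * (a * b) != 0 := mulf_neq0 (lt0r_neq0 w0) (mulf_neq0 a0 b0).
  by apply: (mulIf wab); rewrite mul1r {2}e5; ring.
- have wac : w * (a * c) = - b.
    by apply: (mulfI (lt0r_neq0 w0)); move: b2; rewrite a1 -e4 mulrN => <-; ring.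
  have [w1|wa] := one _ _ a1 a3.
    by apply: Or41; apply: id1 => //; rewrite b1 wac opprK w1 mul1r.
  apply: Or43; have [a0 wE] := invE _ wa; have cE : c = - (a * b).
    by rewrite -mulrN -wac -[LHS]mul1r -wa; ring.
  split=> //; rewrite v'E -e4 a1 b1 wac opprK wE; congr (_, _, _, _).
  + by field.
  + by rewrite cE; field.
- have wbc : w * (b * c) = - a.
    by apply: (mulfI (lt0r_neq0 w0)); move: a2; rewrite b1 -e4 mulrN => <-; ring.
  have [w1|wb] := one _ _ b1 b3.
    by apply: Or41; apply: id1 => //; rewrite a1 wbc opprK w1 mul1r.
  apply: Or44; have [b0 wE] := invE _ wb; have cE : c = - (a * b).
    by rewrite -mulNr -wbc -[LHS]mul1r -wb; ring.
  split=> //; rewrite v'E -e4 a1 b1 wbc opprK wE; congr (_, _, _, _).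
  + by field.
  + by rewrite cE; field.
(* Applying the exchange twice multiplies [a] and [b] by w c^2, which settles the case where one of
   them is nonzero; for a = b = 0 the equation [a3] reads 1 = w c^2. *)
- have wc : w * c ^+ 2 = 1.
    have hz x : w * (w * (x * c) * c) = w * x -> x = 0 \/ w * c ^+ 2 = 1.
      move=> /(mulfI (lt0r_neq0 w0)) h.
      have /eqP : x * (1 - w * c ^+ 2) = 0 by move: h; lra.
      by rewrite mulf_eq0 subr_eq0 => /orP[/eqP|/eqP <-]; [left|right].
    have [|a0|//] := hz a; first by move: a2; rewrite b1 -e4; lra.
    have [|b0|//] := hz b; first by move: b2; rewrite a1 -e4; lra.
    by move: a3; rewrite a1 b0 !(mul0r, mulr0, oppr0, expr0n, addr0, add0r) => <-.
  apply: Or42; have [c0 wE] := invE _ wc; split=> //.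
  rewrite v'E -e4 a1 b1 wE; congr (_, _, _, _); by field.
Qed.

(** The product in [Theta] becomes (1 - a^2)^2 (1 - c^2)^2 for b = - a c and (1 - a^2)^2 (1 - b^2)^2
    for c = - a b. This keeps the parameters listed for a class distinct. *)
Lemma Theta_noncritical a b c v : Theta (a, b, c, v) ->
  ~ (b = - (a * c) /\ c ^+ 2 = 1) /\
  (c = - (a * b) -> a ^+ 2 != 1 /\ b ^+ 2 != 1).
Proof.
move=> [Th _]; split=> [[bE c1]|cE].
  suff : (1 - a ^+ 2) ^+ 2 * (1 - c ^+ 2) ^+ 2 > 0.
    by rewrite c1 subrr expr0n mulr0 ltxx.
  by move: Th; rewrite bE; congr (0 < _); ring.
suff : 0 < (1 - a ^+ 2) ^+ 2 * (1 - b ^+ 2) ^+ 2.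
  by move=> h; split; apply/eqP => h1; move: h; rewrite h1 subrr expr0n ?mul0r ?mulr0 ltxx.
by move: Th; rewrite cE; congr (0 < _); ring.
Qed.

Lemma mem_autocov_class a b c v t : Theta (a, b, c, v) ->
  autocov_class (a, b, c, v) t <->
  [\/ t = (a, b, c, v),
      c != 0 /\ t = (- b / c, - a / c, 1 / c, c ^- 2 * v),
      [/\ c = - (a * b), a != 0 & t = (a^-1, b, - (a^-1 * b), a ^- 2 * v)] |
      [/\ c = - (a * b), b != 0 & t = (a, b^-1, - (a * b^-1), b ^- 2 * v)]].
Proof.
move=> Th; split=> [[Th']|].
  move/(autocov_eqP Th Th').
  by move: t Th' => [[[a' b'] c'] v'] Th'; exact: same_symbol_cases.
have [Thp v0] := Th.
have classI t' : Theta t' -> same_symbol (a, b, c, v) t' -> autocov_class (a, b, c, v) t'.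
  by move=> Th' ?; split=> //; apply/autocov_eqP.
(* Each listed partner divides the product in [Theta] by c^4, a^4 or b^4 and so stays in [Theta]. *)
have scale (x p : R) : x != 0 -> 0 < p * (x ^+ 4) -> 0 < p.
  move=> x0; have x4 : 0 < x ^+ 4 by rewrite exprn_even_gt0.
  by rewrite (pmulr_lgt0 _ x4).
have scalev (x : R) : x != 0 -> 0 < x ^- 2 * v.
  by move=> x0; rewrite mulr_gt0// invr_gt0 exprn_even_gt0.
case=> [->|[c0 ->]|[cE a0 ->]|[cE b0 ->]].
- by split.
- apply: classI; [split; [apply: (scale _ _ c0)|exact: scalev]|].
    by move: Thp; congr (0 < _); field.
  by split; field.
- apply: classI; [split; [apply: (scale _ _ a0)|exact: scalev]|].
    by move: Thp; rewrite cE; congr (0 < _); field.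
  by rewrite cE; split; field.
- apply: classI; [split; [apply: (scale _ _ b0)|exact: scalev]|].
    by move: Thp; rewrite cE; congr (0 < _); field.
  by rewrite cE; split; field.
Qed.

Lemma card_uniq (T : choiceType) (s : seq T) : uniq s ->
  ([set x | x \in s] #= `I_(size s))%card.
Proof.
move=> us; have -> : [set x | x \in s] = [set` [fset x in s]%fset].
  by apply/seteqP; split=> x /=; rewrite inE.
by apply/card_eq_fsetP; rewrite card_fseq undup_id.
Qed.

Lemma card_pair (T : choiceType) (x y : T) : x != y -> ([set x; y] #= `I_2)%card.
Proof.
move=> xy; rewrite (_ : [set x; y] = [set z | z \in [:: x; y]]).
  by apply: (@card_uniq _ [:: x; y]); rewrite /= inE xy.
apply/seteqP; split=> z /=; rewrite !inE.
  by case=> ->; rewrite eqxx ?orbT.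
by case/orP => /eqP ->; [left|right].
Qed.

End classes.

Unset Implicit Arguments.

Theorem corollary2 (R : realType) :
  (* generic case *)
  (forall a b c v : R, Theta (a, b, c, v) -> c != - (a * b) -> c != 0 ->
     (autocov_class (a, b, c, v) #= `I_2)%card /\
     autocov_class (a, b, c, v) =
       [set (a, b, c, v); (- b / c, - a / c, 1 / c, c ^- 2 * v)]) /\
  (* symmetric case c = - a b != 0 *)
  (forall a b c v : R, Theta (a, b, c, v) -> c = - (a * b) -> c != 0 ->
     (autocov_class (a, b, c, v) #= `I_4)%card /\
     autocov_class (a, b, c, v) =
       [set (a, b, - (a * b), v);
            (a^-1, b^-1, - (a^-1 * b^-1), a ^- 2 * b ^- 2 * v);
            (a^-1, b, - (a^-1 * b), a ^- 2 * v);
            (a, b^-1, - (a * b^-1), b ^- 2 * v)]) /\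
  (* symmetric case with exactly one nonzero coefficient, a or b *)
  (forall a v : R, Theta (a, 0, 0, v) -> a != 0 ->
     (autocov_class (a, 0, 0, v) #= `I_2)%card /\
     autocov_class (a, 0, 0, v) =
       [set (a, 0, 0, v); (a^-1, 0, 0, a ^- 2 * v)]) /\
  (forall b v : R, Theta (0, b, 0, v) -> b != 0 ->
     (autocov_class (0, b, 0, v) #= `I_2)%card /\
     autocov_class (0, b, 0, v) =
       [set (0, b, 0, v); (0, b^-1, 0, b ^- 2 * v)]) /\
  (* one-element classes *)
  (forall a b v : R, Theta (a, b, 0, v) -> a * b != 0 ->
     autocov_class (a, b, 0, v) = [set (a, b, 0, v)]) /\
  (forall v : R, Theta (0, 0, 0, v) ->
     autocov_class (0, 0, 0, v) = [set (0, 0, 0, v)]).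
Proof.
have inv_neq (x : R) : x != 0 -> x ^+ 2 != 1 -> x != x^-1.
  by move=> x0; apply: contra_neq => xV; rewrite expr2 {2}xV divff.
split; [|split; [|split; [|split; [|split]]]].
- move=> a b c v Th cab c0; have [nc _] := Theta_noncritical Th.
  have -> : autocov_class (a, b, c, v) =
      [set (a, b, c, v); (- b / c, - a / c, 1 / c, c ^- 2 * v)].
    apply/seteqP; split=> t; rewrite mem_autocov_class//.
      by case=> [->|[_ ->]|[cE]|[cE]]; [left|right| |]; rewrite // cE eqxx in cab.
    by case=> ->; [exact: Or41|exact: Or42].
  split=> //; apply: card_pair; apply/eqP => -[aE bE cE _]; apply: nc.
  have c1 : c ^+ 2 = 1 by rewrite expr2 {2}cE div1r divff.
  by split=> //; rewrite aE; field.
- move=> a b c v Th cE c0; have [_ /(_ cE)[a1 b1]] := Theta_noncritical Th.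
  have a0 : a != 0 by apply: contra_neq c0 => a0; rewrite cE a0 mul0r oppr0.
  have b0 : b != 0 by apply: contra_neq c0 => b0; rewrite cE b0 mulr0 oppr0.
  (* In the symmetric case the generic partner is the inversion of both coefficients. *)
  have dualE : (- b / c, - a / c, 1 / c, c ^- 2 * v) =
      (a^-1, b^-1, - (a^-1 * b^-1), a ^- 2 * b ^- 2 * v).
    by rewrite cE; congr (_, _, _, _); field; rewrite a0 b0.
  have -> : autocov_class (a, b, c, v) =
       [set (a, b, - (a * b), v);
            (a^-1, b^-1, - (a^-1 * b^-1), a ^- 2 * b ^- 2 * v);
            (a^-1, b, - (a^-1 * b), a ^- 2 * v);
            (a, b^-1, - (a * b^-1), b ^- 2 * v)].
    apply/seteqP; split=> t; rewrite mem_autocov_class// dualE -cE.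
      by case=> [->|[_ ->]|[_ _ ->]|[_ _ ->]]; rewrite /=; tauto.
    by case=> [[[->|->]|->]|->]; [exact: Or41|exact: Or42|exact: Or43|exact: Or44].
  split=> //; set s := (X in (X #= _)%card).
  pose l := [:: (a, b, - (a * b), v);
            (a^-1, b^-1, - (a^-1 * b^-1), a ^- 2 * b ^- 2 * v);
            (a^-1, b, - (a^-1 * b), a ^- 2 * v);
            (a, b^-1, - (a * b^-1), b ^- 2 * v)].
  have -> : s = [set x | x \in l].
    apply/seteqP; split=> t; rewrite /s /l /= !inE.
      by case=> [[[->|->]|->]|->]; rewrite eqxx ?orbT.
    by case/or4P => /eqP ->; tauto.
  apply: (@card_uniq _ l).
  have [/negPf na /negPf nb] := (inv_neq _ a0 a1, inv_neq _ b0 b1).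
  have [na' nb'] : (a^-1 == a) = false /\ (b^-1 == b) = false by rewrite eq_sym na eq_sym nb.
  by rewrite /l /= !inE !xpair_eqE !(na, na', nb, nb') /= !andbF.
(* For b = c = 0 the relation c = - a b holds, and only the inversion of [a] remains possible
   besides the parameter itself. *)
- move=> a v Th a0; have [_ /(_ _)[|a1 _]] := Theta_noncritical Th.
    by rewrite mulr0 oppr0.
  have -> : autocov_class (a, 0, 0, v) =
      [set (a, 0, 0, v); (a^-1, 0, 0, a ^- 2 * v)].
    apply/seteqP; split=> t; rewrite mem_autocov_class// !mulr0 oppr0 eqxx.
      by case=> [->|[]|[_ _ ->]|[]] //; [left|right].
    by case=> ->; [exact: Or41|exact: Or43].
  by split=> //; apply: card_pair; rewrite !xpair_eqE (negPf (inv_neq _ a0 a1)).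
- move=> b v Th b0; have [_ /(_ _)[|_ b1]] := Theta_noncritical Th.
    by rewrite mul0r oppr0.
  have -> : autocov_class (0, b, 0, v) =
      [set (0, b, 0, v); (0, b^-1, 0, b ^- 2 * v)].
    apply/seteqP; split=> t; rewrite mem_autocov_class// !mul0r oppr0 eqxx.
      by case=> [->|[]|[]|[_ _ ->]] //; [left|right].
    by case=> ->; [exact: Or41|exact: Or44].
  by split=> //; apply: card_pair; rewrite !xpair_eqE (negPf (inv_neq _ b0 b1)) andbF.
- move=> a b v Th ab0; apply/seteqP; split=> t; rewrite mem_autocov_class//.
    by case=> [->|[]|[/esym/eqP]|[/esym/eqP]]; rewrite ?eqxx// oppr_eq0 (negPf ab0).
  by move=> ->; exact: Or41.
- move=> v Th; apply/seteqP; split=> t; rewrite mem_autocov_class//.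
    by case=> [->|[]|[]|[]]; rewrite ?eqxx.
  by move=> ->; exact: Or41.
Qed.
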